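(* Let $X=\mathcal{S}(\mathbb{R}^n)$ or $\mathcal{V}(\mathbb{R}^n)$, let $K\in\mathcal{K}^n_{(o)}$ be $o$-symmetric (i.e. $K=-K$), and let $T:X\to X$ be a rearrangement. The following are equivalent. (i) $T$ reduces the $K$-modulus of continuity, i.e. $\omega_{K,d}(Tf)\le\omega_{K,d}(f)$ for all $d>0$ and $f\in X$. (ii) $T$ reduces the $K$-modulus of continuity of each $K$-contraction in $X$, i.e. $\omega_{K,d}(Tf)\le\omega_{K,d}(f)$ for all $d>0$ and all $K$-contractions $f\in X$. (iii) $T$ is $K$-smoothing.
   Context: Throughout $n\ge 2$ and $\mathcal{H}^n$ is $n$-dimensional Hausdorff (Lebesgue) measure in $\mathbb{R}^n$. ''Essentially'' means up to a set of $\mathcal{H}^n$-measure zero. $\mathcal{M}^n$ is the class of measurable subsets of $\mathbb{R}^n$ and $\mathcal{L}^n$ the class of measurable sets of finite measure. $\mathcal{K}^n_{(o)}$ is the class of compact convex subsets of $\mathbb{R}^n$ containing the origin in their interiors. $\mathcal{S}(\mathbb{R}^n)$ is the set of real-valued measurable functions $f$ on $\mathbb{R}^n$ with $\mathcal{H}^n(\{x:f(x)>t\})<\infty$ for all $t>\operatorname{ess\,inf} f$; $\mathcal{V}(\mathbb{R}^n)$ is the set of nonnegative real-valued measurable functions $f$ with $\mathcal{H}^n(\{x:f(x)>t\})<\infty$ for all $t>0$. A rearrangement $T:X\to X$ is a map that is equimeasurable, i.e. $\mathcal{H}^n(\{x:Tf(x)>t\})=\mathcal{H}^n(\{x:f(x)>t\})$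 for all $t\in\mathbb{R}$ and $f\in X$, and monotonic, i.e. for $f,g\in X$, $f\le g$ essentially implies $Tf\le Tg$ essentially. The gauge function of $K$ is $\|x\|_K=\inf\{\lambda\ge0:x\in\lambda K\}$. A function $f:\mathbb{R}^n\to\mathbb{R}$ is a $K$-contraction if $|f(x)-f(y)|\le\|x-y\|_K$ for all $x,y\in\mathbb{R}^n$. For $d>0$, $\omega_{K,d}(f)=\operatorname{ess\,sup}_{\|x-y\|_K\le d}|f(x)-f(y)|$, the essential supremum over $\{(x,y)\in\mathbb{R}^n\times\mathbb{R}^n:\|x-y\|_K\le d\}$ with respect to $2n$-dimensional Lebesgue measure. For $A\in\mathcal{M}^n$, $A^*$ denotes the set of Lebesgue density points of $A$ (points of $\mathbb{R}^n$ where $A$ has density $1$). For $A\in\mathcal{L}^n$ put $\diamondsuit_TA=\{x:T1_A(x)=1\}$ and $\diamondsuit_T^*A=(\diamondsuit_TA)^*$. $T$ is $K$-smoothing if for each $d>0$ and each bounded $A\in\mathcal{M}^n$, $(\diamondsuit_T^*A)+dK\subset\diamondsuit_T^*(A+dK)$, essentially (Minkowski sums). *)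

(* Defs.v *)
From HB Require Import structures.
From mathcomp Require Import all_boot all_order all_algebra.
From mathcomp Require Import all_classical all_reals all_analysis.
From mathcomp Require Import ess_sup_inf.
Import Order.TTheory GRing.Theory Num.Theory.
Import numFieldNormedType.Exports.

Set Implicit Arguments.
Unset Strict Implicit.
Unset Printing Implicit Defensive.

Local Open Scope classical_set_scope.
Local Open Scope ring_scope.

(* R^n is 'rV[R]_n. Its Lebesgue measure is obtained, as the library's
   completed_lebesgue_measure for n = 1, by restricting the outer measure
   coming from half-open boxes to its Caratheodory measurable sets, so that
   "measurable" means Lebesgue measurable (not just Borel). *)

Definition box (R : realType) (n : nat) (c : 'rV[R]_n * 'rV[R]_n) :
  set 'rV[R]_n := [set x | forall i, x 0 i \in `]c.1 0 i, c.2 0 i]].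

Definition box_volume (R : realType) (n : nat) (c : 'rV[R]_n * 'rV[R]_n) : R :=
  \prod_i Num.max 0 (c.2 0 i - c.1 0 i).

(* The index set D of a cover may be any set of naturals: infinite covers
   alone would give the empty set of R^0 infinite measure. *)
Definition lebesgue_outer (R : realType) (n : nat) (A : set 'rV[R]_n) :
    \bar R :=
  ereal_inf [set s | exists (D : set nat) (B : nat -> 'rV[R]_n * 'rV[R]_n),
    A `<=` \bigcup_(k in D) box (B k) /\
    s = \esum_(k in D) (box_volume (B k))%:E].

Lemma box_volume_ge0 (R : realType) (n : nat) (c : 'rV[R]_n * 'rV[R]_n) :
  0 <= box_volume c.
Proof. by apply: prodr_ge0 => i _; rewrite le_max lexx. Qed.

Lemma lebesgue_outer_ge0 (R : realType) (n : nat) (A : set 'rV[R]_n) :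
  (0 <= lebesgue_outer A)%E.
Proof.
apply: le_ereal_inf_tmp => _ [D [B [_ ->]]].
by apply: esum_ge0 => k _; rewrite lee_fin box_volume_ge0.
Qed.

Lemma lebesgue_outer0 (R : realType) (n : nat) :
  @lebesgue_outer R n set0 = 0%E.
Proof.
apply/eqP; rewrite eq_le lebesgue_outer_ge0 andbT.
apply: ereal_inf_lbound; exists set0, (fun=> (0, 0)).
by split; [exact: sub0set|rewrite esum_set0].
Qed.

Lemma le_lebesgue_outer (R : realType) (n : nat) :
  {homo @lebesgue_outer R n : A B / A `<=` B >-> (A <= B)%E}.
Proof.
move=> A B AB; apply: ereal_inf_le_tmp => _ [D [C [BC ->]]].
by exists D, C; split=> //; exact: subset_trans BC.
Qed.

Lemma lebesgue_outer_sigma_subadditive (R : realType) (n : nat) :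
  sigma_subadditive (@lebesgue_outer R n).
Proof.
move=> A; have [[i ioo]|] := pselect (exists i, lebesgue_outer (A i) = +oo%E).
  rewrite (eseries_pinfty _ _ ioo) ?leey// => k _.
  by rewrite -ltNye (lt_le_trans _ (lebesgue_outer_ge0 _)).
rewrite -forallNE => Aoo.
suff add2e (e : {posnum R}) : (lebesgue_outer (\bigcup_n A n) <=
    \sum_(i <oo) lebesgue_outer (A i) + e%:num%:E)%E.
  by apply/lee_addgt0Pr => _/posnumP[].
rewrite (le_trans _ (epsilon_trick _ _ _))//; last first.
  by move=> k; exact: lebesgue_outer_ge0.
pose P k (G : set nat * (nat -> 'rV[R]_n * 'rV[R]_n)) :=
  A k `<=` \bigcup_(j in G.1) box (G.2 j) /\
  (\esum_(j in G.1) (box_volume (G.2 j))%:E <=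
   lebesgue_outer (A k) + (e%:num / (2 ^ k.+1)%:R)%:E)%E.
have [G PG] : {G & forall k, P k (G k)}.
  apply: (@choice _ _ P) => k.
  have Afin : lebesgue_outer (A k) \is a fin_num.
    by rewrite ge0_fin_numE ?lebesgue_outer_ge0// ltey; apply/eqP/Aoo.
  have en1 : 0 < e%:num / (2 ^ k.+1)%:R :> R by [].
  have [_ [D [B [AB ->]] lt_s]] := lb_ereal_inf_adherent en1 Afin.
  by exists (D, B); split=> //=; exact: ltW.
have vol0 c : (0 <= (@box_volume R n c)%:E)%E by rewrite lee_fin box_volume_ge0.
have /card_esym/ppcard_eqP[f] := card_nat2.
pose D := [set k | (G (f k).1).1 (f k).2].
apply: (@le_trans _ _ (\esum_(k in D) (box_volume ((G (f k).1).2 (f k).2))%:E)).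
  apply: ereal_inf_lbound; exists D, (fun k => (G (f k).1).2 (f k).2).
  split=> // x [k _ /(PG k).1[j Gj xj]].
  have fK : f (f^-1%FUN (k, j)) = (k, j) by rewrite invK ?inE.
  by exists (f^-1%FUN (k, j)); rewrite /D /= fK.
rewrite -(@reindex_esum _ _ _ D ([set: nat] `*`` (fun k => (G k).1)) f
  (fun p => (box_volume ((G p.1).2 p.2))%:E)); last first.
  split=> [k //|k l _ _ fkl|[k j] [_ /= Gj]].
  - by apply: (@inj _ _ setT f); rewrite ?inE.
  - have fK : f (f^-1%FUN (k, j)) = (k, j) by rewrite invK ?inE.
    by exists (f^-1%FUN (k, j)); rewrite /D /= fK.
rewrite -(@esum_esum _ _ _ setT (fun k => (G k).1)
  (fun k j => (box_volume ((G k).2 j))%:E))//.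
rewrite -nneseries_esumT; last by move=> k; apply: esum_ge0.
apply: lee_nneseries => [k _ _|k _].
  by apply: esum_ge0.
by have [_ ?] := PG k.
Qed.

HB.instance Definition _ (R : realType) (n : nat) :=
  isOuterMeasure.Build R 'rV[R]_n (@lebesgue_outer R n)
    (@lebesgue_outer0 R n) (@lebesgue_outer_ge0 R n) (@le_lebesgue_outer R n)
    (@lebesgue_outer_sigma_subadditive R n).

Notation Rn R n := (caratheodory_type (@lebesgue_outer R n)).

Definition lebesgue (R : realType) (n : nat) : set (Rn R n) -> \bar R :=
  @lebesgue_outer R n.
HB.instance Definition _ (R : realType) (n : nat) :=
  isMeasure.Build _ _ R (@lebesgue R n)
    (@caratheodory_measure0 _ _ (@lebesgue_outer R n))
    (@caratheodory_measure_ge0 _ _ (@lebesgue_outer R n))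
    (@caratheodory_measure_sigma_additive _ _ (@lebesgue_outer R n)).

Definition space_S (R : realType) (n : nat) : set ('rV[R]_n -> R) :=
  [set f : 'rV[R]_n -> R | measurable_fun [set: Rn R n] (f : Rn R n -> R) /\
    forall t : R, (ess_inf (@lebesgue R n) (EFin \o f) < t%:E)%E ->
      (lebesgue [set x | (t < f x)%R] < +oo)%E].

Definition space_V (R : realType) (n : nat) : set ('rV[R]_n -> R) :=
  [set f : 'rV[R]_n -> R |
    [/\ measurable_fun [set: Rn R n] (f : Rn R n -> R),
        forall x, 0 <= f x &
        forall t : R, 0 < t -> (lebesgue [set x | (t < f x)%R] < +oo)%E]].

(* T is given on all functions; only its values on X are constrained. *)
Definition rearrangement (R : realType) (n : nat) (X : set ('rV[R]_n -> R))
    (T : ('rV[R]_n -> R) -> ('rV[R]_n -> R)) : Prop :=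
  [/\ forall f, X f -> X (T f),
      forall f, X f -> forall t : R,
        lebesgue [set x | t < T f x] = lebesgue [set x | t < f x] &
      forall f g, X f -> X g ->
        (\forall x \ae @lebesgue R n, f x <= g x) ->
        (\forall x \ae @lebesgue R n, T f x <= T g x)].

Definition minkowski_sum (R : realType) (n : nat) (A B : set 'rV[R]_n) :
  set 'rV[R]_n := [set a + b | a in A & b in B].

Definition dilate (R : realType) (n : nat) (l : R) (A : set 'rV[R]_n) :
  set 'rV[R]_n := [set l *: x | x in A].

Definition convex_body_o (R : realType) (n : nat) (K : set 'rV[R]_n) : Prop :=
  [/\ compact K, convex_set (K : set (convex_lmodType 'rV[R]_n)) & K^° 0].

Definition o_symmetric (R : realType) (n : nat) (K : set 'rV[R]_n) : Prop :=
  K = [set - x | x in K].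

Definition gauge (R : realType) (n : nat) (K : set 'rV[R]_n) (x : 'rV[R]_n) :
  R := inf [set l : R | 0 <= l /\ dilate l K x].

Definition K_contraction (R : realType) (n : nat) (K : set 'rV[R]_n)
    (f : 'rV[R]_n -> R) : Prop :=
  forall x y, `|f x - f y| <= gauge K (x - y).

(* The essential supremum over {(x, y) | ||x - y||_K <= d}; the pair (x, y) is
   the row vector z = row_mx x y of R^(n + n). *)
Definition K_modulus (R : realType) (n : nat) (K : set 'rV[R]_n) (d : R)
    (f : 'rV[R]_n -> R) : \bar R :=
  ereal_inf [set s | \forall z \ae @lebesgue R (n + n),
    gauge K (lsubmx z - rsubmx z) <= d ->
    (`|f (lsubmx z) - f (rsubmx z)|%:E <= s)%E].

Definition euclidean_ball (R : realType) (n : nat) (x : 'rV[R]_n) (r : R) :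
  set 'rV[R]_n := [set y | Num.sqrt (\sum_i (y 0 i - x 0 i) ^+ 2) < r].

Definition density_points (R : realType) (n : nat) (A : set 'rV[R]_n) :
    set 'rV[R]_n :=
  [set x | fine (lebesgue (A `&` euclidean_ball x r)) /
           fine (lebesgue (euclidean_ball x r)) @[r --> (0 : R)^'+] --> (1 : R)].

Definition diamond (R : realType) (n : nat)
    (T : ('rV[R]_n -> R) -> ('rV[R]_n -> R)) (A : set 'rV[R]_n) :
  set 'rV[R]_n := [set x | T (\1_A) x = 1].

Definition diamond_star (R : realType) (n : nat)
    (T : ('rV[R]_n -> R) -> ('rV[R]_n -> R)) (A : set 'rV[R]_n) :
  set 'rV[R]_n := density_points (diamond T A).

Definition K_smoothing (R : realType) (n : nat) (K : set 'rV[R]_n)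
    (T : ('rV[R]_n -> R) -> ('rV[R]_n -> R)) : Prop :=
  forall (d : R) (A : set 'rV[R]_n), 0 < d -> bounded_set A ->
    measurable (A : set (Rn R n)) ->
    (@lebesgue R n).-negligible
      (minkowski_sum (diamond_star T A) (dilate d K) `\`
       diamond_star T (minkowski_sum A (dilate d K))).

(* Main.v *)
Require Import Defs.
From HB Require Import structures.
From mathcomp Require Import all_boot all_order all_algebra.
From mathcomp Require Import all_classical all_reals all_analysis.
From mathcomp Require Import ess_sup_inf measurable_realfun ring lra.
Import Order.TTheory GRing.Theory Num.Theory.
Import numFieldNormedType.Exports.

Set Implicit Arguments.
Unset Strict Implicit.
Unset Printing Implicit Defensive.

Local Open Scope classical_set_scope.
Local Open Scope ring_scope.

(* A rearrangement maps the superlevel sets of f, up to null sets, to those of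
   T f by A |-> diamond A. If T is smoothing and |f x - f y| <= r for almost all
   pairs at gauge distance at most d, then the density points of {f > t + r}
   plus d K lie essentially in {f > t} (otherwise two density points would yield
   a non-null set of bad pairs), hence {T f > t + r} plus d K lies essentially in
   {T f > t}; letting t run over the rationals bounds the modulus of T f.
   Conversely, the modulus condition for the contraction
   f = max (0, d - dist_K (., A)) keeps the points of diamond A, where T f >= d
   essentially, at gauge distance at least d from {T f <= 0}, whose complement
   is diamond {f > 0}, a subset of diamond (A + d K). The boundary of a union of
   translates of d K is null by Lebesgue's density theorem, which is proved here
   in R^n by Vitali's covering argument. *)

(** * Lebesgue measure of boxes and products *)

(** Smoothing concerns points of a Minkowski sum, the modulus concerns almost all pairs in R^(n+n).
    The link is a lower bound for the outer measure of a product, valid for arbitrary factors: two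
    points at gauge distance strictly below d, near each of which a set is nowhere null, give a
    non-null set of close pairs whose measurability never has to be examined. Strictness leaves room
    to move both points; pairs at distance exactly d have no such room, and this is why the boundary
    of A + d K must be shown null. The same fact makes A + d K measurable for every A, so that T can
    be applied to its indicator function. Two more obstacles shape the passage from sets to
    functions. [K_smoothing] covers bounded sets only, while superlevel sets merely have finite
    measure: they are exhausted by bounded pieces, and equimeasurability shows that the images of
    the pieces exhaust the image. At low levels a superlevel set may have infinite measure; there t
    is an essential lower bound of T f, and nothing is left to prove. *)

Lemma lebesgue_outer_box_le (R : realType) (n : nat) (c : 'rV[R]_n * 'rV[R]_n) :
  (lebesgue_outer (box c) <= (box_volume c)%:E)%E.
Proof.
apply: ereal_inf_lbound; exists [set 0%N], (fun=> c); split.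
  by move=> x cx; exists 0%N.
by rewrite esum_set1// lee_fin box_volume_ge0.
Qed.

(** Truncation of the side lengths at 0 makes this hold wherever the hyperplane lies: a piece on the
    wrong side of the box has volume 0. *)
Lemma box_volume_split (R : realType) (n : nat) (i : 'I_n) (a : R)
    (c : 'rV[R]_n * 'rV[R]_n) :
  let c1 := (c.1, \row_j if j == i then Num.min a (c.2 0 j) else c.2 0 j) in
  let c2 := (\row_j (if j == i then Num.max a (c.1 0 j) else c.1 0 j), c.2) in
  box_volume c1 + box_volume c2 = box_volume c.
Proof.
rewrite /box_volume /= (bigD1 i)//= [X in _ + X](bigD1 i)//= [RHS](bigD1 i)//=.
rewrite !mxE eqxx.
under eq_bigr => j /negPf ji do rewrite mxE ji.
under [in X in _ + X]eq_bigr => j /negPf ji do rewrite mxE ji.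
rewrite -mulrDl; congr (_ * _).
rewrite /Order.max /Order.min.
have [h1|h1] := ltP a (c.2 0 i); have [h2|h2] := ltP a (c.1 0 i);
repeat case: ltP => ?; lra.
Qed.

(** Cutting every box of a cover of [X] along the hyperplane yields covers of the two parts of [X]
    with the same total volume, which is Caratheodory's criterion. *)
Lemma halfspace_measurable (R : realType) (n : nat) (i : 'I_n) (a : R) :
  measurable ([set x | x 0 i <= a] : set (Rn R n)).
Proof.
apply: le_caratheodory_measurable => X.
apply: le_ereal_inf_tmp => _ [D [B [XB ->]]].
pose B1 k := ((B k).1, \row_j if j == i then Num.min a ((B k).2 0 j) else (B k).2 0 j).
pose B2 k := (\row_j (if j == i then Num.max a ((B k).1 0 j) else (B k).1 0 j), (B k).2).
have -> : \esum_(k in D) (box_volume (B k))%:E =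
  (\esum_(k in D) (box_volume (B1 k))%:E + \esum_(k in D) (box_volume (B2 k))%:E)%E.
  rewrite -esumD => [|k _|k _]; try by rewrite lee_fin box_volume_ge0.
  by apply: eq_esum => k _; rewrite -EFinD box_volume_split.
apply: leeD; apply: ereal_inf_lbound.
  exists D, B1; split=> // x [/XB[k Dk Bx] /= xa]; exists k => // j.
  have /= := Bx j; rewrite !in_itv/= mxE => /andP[-> h]/=.
  by case: eqP => // ->; rewrite le_min xa/=; have := Bx i; rewrite in_itv/= => /andP[].
exists D, B2; split=> // x [/XB[k Dk Bx] /= /negP xa]; exists k => // j.
have /= := Bx j; rewrite !in_itv/= mxE => /andP[h ->]; rewrite andbT.
case: eqP => // ->; rewrite gt_max ltNge; apply/andP; split=> //.
by have := Bx i; rewrite in_itv/= => /andP[].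
Qed.

Lemma box_measurable (R : realType) (n : nat) (c : 'rV[R]_n * 'rV[R]_n) :
  measurable (box c : set (Rn R n)).
Proof.
have -> : (box c : set (Rn R n)) = \bigcap_(i in [set: 'I_n])
    ([set x : Rn R n | x 0 i <= c.2 0 i] `&` ~` [set x : Rn R n | x 0 i <= c.1 0 i]).
  apply/seteqP; split=> x /= xc i => [_|]; have := xc i.
    by rewrite in_itv/= => /andP[? ?]; split=> //=; apply/negP; rewrite -ltNge.
  by move=> /(_ Logic.I)[/= ? /negP]; rewrite -ltNge in_itv/= => ->.
apply: fin_bigcap_measurable; first exact: finite_finset.
move=> i _; apply: measurableI; first exact: halfspace_measurable.
by apply: measurableC; exact: halfspace_measurable.
Qed.

(** Row vectors carry the maximum norm, so for positive [r] the box with these corners is [ball x r]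
    up to boundary points. *)
Definition cube (R : realType) (n : nat) (x : 'rV[R]_n) (r : R) :=
  (x - const_mx r, x + const_mx r).

Lemma cubeP (R : realType) (n : nat) (x : 'rV[R]_n) (r : R) y :
  box (cube x r) y <-> forall i, x 0 i - r < y 0 i <= x 0 i + r.
Proof. by split=> h i; have := h i; rewrite in_itv/= !mxE. Qed.

Lemma ballP_rV (R : realType) (n : nat) (x y : 'rV[R]_n) (r : R) : 0 < r ->
  ball x r y <-> forall i, `|x 0 i - y 0 i| < r.
Proof.
move=> r0; split => [[_ h] i|h]; first exact: h.
by split=> // i j; rewrite [i]ord1; exact: h.
Qed.

Lemma rat_vector_near (R : realType) (n : nat) (x : 'rV[R]_n) (r : R) : 0 < r ->
  exists q : 'rV[rat]_n, forall i, `|x 0 i - ratr (q 0 i)| < r.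
Proof.
move=> r0.
have /choice[q qP] : forall i : 'I_n, exists q : rat, `|x 0 i - ratr q| < r.
  move=> i; have [q] := @rat_in_itvoo R (x 0 i - r) (x 0 i + r) ltac:(lra).
  by rewrite in_itv/= => /andP[? ?]; exists q; rewrite ltr_norml; lra.
by exists (\row_i q i) => i; rewrite mxE.
Qed.

(** An open set is the union of the countably many cubes with rational centre and half-side 1/(k+1)
    that it contains. *)
Lemma open_measurable_rV (R : realType) (n : nat) (U : set 'rV[R]_n) :
  open U -> measurable (U : set (Rn R n)).
Proof.
move=> oU.
pose F (p : 'rV[rat]_n * nat) : set (Rn R n) :=
  if pselect (box (cube (map_mx ratr p.1) p.2.+1%:R^-1) `<=` U)
  then box (cube (map_mx ratr p.1) p.2.+1%:R^-1) else set0.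
have -> : (U : set (Rn R n)) = \bigcup_p F p.
  apply/seteqP; split => x; last first.
    by case=> p _; rewrite /F; case: pselect => // h /h.
  move=> Ux; have /nbhs_ballP[e /= e0 xeU] := open_nbhs_nbhs (conj oU Ux).
  have [k ke] : exists k, k.+1%:R^-1 < e / 2.
    near \oo => k; exists k; near: k.
    by apply: near_infty_natSinv_lt (PosNum _); rewrite divr_gt0.
  have k0 : 0 < k.+1%:R^-1 :> R by [].
  have [q qP] := rat_vector_near x k0.
  exists (q, k) => //; rewrite /F.
  have xq : box (cube (map_mx ratr q) k.+1%:R^-1) x.
    apply/cubeP => i; have := qP i; rewrite mxE ltr_norml => /andP[].
    by move: (_^-1) (ratr _) (x 0 i) => d v u *; apply/andP; split; lra.
  case: pselect => //= nU; exfalso; apply: nU => y /cubeP yq; apply: xeU.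
  apply/ballP_rV => // i; have := yq i; have := qP i.
  move: (y 0 i) ke => yi; rewrite mxE !ltr_norml; move: (_^-1) (ratr _) (x 0 i) => d v u.
  by move=> ? /andP[? ?] /andP[? ?]; apply/andP; split; lra.
apply: countable_bigcupT_measurable => [|p]; first exact: countableP.
by rewrite /F; case: pselect => ? /=; [exact: box_measurable|exact: measurable0].
Unshelve. all: by end_near. Qed.

Lemma lebesgue_outer_lt_cover (R : realType) (n : nat) (A : set 'rV[R]_n) (s : \bar R) :
  (lebesgue_outer A < s)%E -> exists (D : set nat) (B : nat -> 'rV[R]_n * 'rV[R]_n),
    A `<=` \bigcup_(k in D) box (B k) /\ (\esum_(k in D) (box_volume (B k))%:E < s)%E.
Proof. by move=> /ereal_inf_lt[_ [D [B [AB ->]]] ?]; exists D, B. Qed.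

Lemma lebesgue_outer_null_subset (R : realType) (n : nat) (A B : set 'rV[R]_n) :
  A `<=` B -> lebesgue_outer B = 0%E -> lebesgue_outer A = 0%E.
Proof.
move=> AB B0; apply/eqP; rewrite eq_le lebesgue_outer_ge0 andbT -B0.
exact: le_lebesgue_outer.
Qed.

Lemma lebesgue_outer_null_bigcup (R : realType) (n : nat) (A : nat -> set 'rV[R]_n) :
  (forall k, lebesgue_outer (A k) = 0%E) -> lebesgue_outer (\bigcup_k A k) = 0%E.
Proof.
move=> A0; apply/eqP; rewrite eq_le lebesgue_outer_ge0 andbT.
rewrite (le_trans (lebesgue_outer_sigma_subadditive _))// eseries0//.
Qed.

Lemma lebesgue_outer_null_setU (R : realType) (n : nat) (A B : set 'rV[R]_n) :
  lebesgue_outer A = 0%E -> lebesgue_outer B = 0%E -> lebesgue_outer (A `|` B) = 0%E.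
Proof.
move=> A0 B0; apply/eqP; rewrite eq_le lebesgue_outer_ge0 andbT.
by rewrite (le_trans (outer_measureU2 _ _ _))//= A0 B0 adde0.
Qed.

(** * Outer measure of products of sets *)

Definition rows_prod (R : realType) (m n : nat) (P : set 'rV[R]_m) (Q : set 'rV[R]_n) :
    set 'rV[R]_(m + n) :=
  [set z | P (lsubmx z) /\ Q (rsubmx z)].

Definition lbox (R : realType) (m n : nat) (c : 'rV[R]_(m + n) * 'rV[R]_(m + n)) :=
  (lsubmx c.1, lsubmx c.2).

Definition rbox (R : realType) (m n : nat) (c : 'rV[R]_(m + n) * 'rV[R]_(m + n)) :=
  (rsubmx c.1, rsubmx c.2).

Lemma box_rows_prod (R : realType) (m n : nat) (c : 'rV[R]_(m + n) * 'rV[R]_(m + n)) :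
  box c = rows_prod (box (lbox c)) (box (rbox c)).
Proof.
apply/seteqP; split => z.
  by move=> cz; split=> i; rewrite !mxE; exact: cz.
move=> [lz rz] i; case: (split_ordP i) => j ->.
  by have := lz j; rewrite !mxE.
by have := rz j; rewrite !mxE.
Qed.

Lemma box_volume_rows (R : realType) (m n : nat) (c : 'rV[R]_(m + n) * 'rV[R]_(m + n)) :
  box_volume c = box_volume (lbox c) * box_volume (rbox c).
Proof.
rewrite /box_volume big_split_ord/=.
by congr (_ * _); apply: eq_bigr => i _; rewrite !mxE.
Qed.

(* Chebyshev's inequality for the function counting, with the volumes of their
   second factors, the boxes whose first factor contains a given point. *)
Lemma lebesgue_outer_rows_prod_ge (R : realType) (m n : nat)
    (P : set 'rV[R]_m) (Q : set 'rV[R]_n) :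
  (lebesgue_outer P * lebesgue_outer Q <= lebesgue_outer (rows_prod P Q))%E.
Proof.
apply: le_ereal_inf_tmp => _ [D [B [PQB ->]]].
pose w k := if k \in D then box_volume (rbox (B k)) else 0.
have w0 k : 0 <= w k by rewrite /w; case: ifP => // _; exact: box_volume_ge0.
pose f k (x : Rn R m) := ((w k)%:E * (\1_(box (lbox (B k)) : set (Rn R m)) x)%:E)%E.
have f0 k x : (0 <= f k x)%E by rewrite mule_ge0// lee_fin.
have mb k : measurable (box (lbox (B k)) : set (Rn R m)) by exact: box_measurable.
have mi k : measurable_fun [set: Rn R m]
    (EFin \o (\1_(box (lbox (B k)) : set (Rn R m)) : Rn R m -> R)).
  by apply/measurable_EFinP; exact: measurable_indic.
have mf k : measurable_fun [set: Rn R m] (f k).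
  exact: (@emeasurable_funM _ _ _ _ (cst (w k)%:E) _ (measurable_cst _) (mi k)).
pose g x := (\sum_(k <oo) f k x)%E.
have mg : measurable_fun [set: Rn R m] g by exact: ge0_emeasurable_sum.
have g0 x : (0 <= g x)%E by exact: nneseries_ge0.
have Pg x : P x -> (lebesgue_outer Q <= g x)%E.
  move=> Px; rewrite /g nneseries_esumT//.
  apply: (@le_trans _ _ (\esum_(k in D `&` [set k | box (lbox (B k)) x])
    (box_volume (rbox (B k)))%:E)).
    apply: ereal_inf_lbound; eexists; exists (fun k => rbox (B k)); split; last reflexivity.
    move=> y Qy; have [|k Dk] := PQB (row_mx x y).
      by split; rewrite ?row_mxKl ?row_mxKr.
    by rewrite box_rows_prod => -[]; rewrite row_mxKl row_mxKr; exists k.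
  rewrite esum_mkcond; apply: le_esum => k _.
  rewrite /f /w indicE in_setI.
  have -> : (k \in [set k | box (lbox (B k)) x]) = (x \in (box (lbox (B k)) : set (Rn R m))).
    by apply/idP/idP; rewrite !inE.
  by case: (k \in D); case: (_ \in _); rewrite ?mule1 ?mule0.
pose q := lebesgue_outer Q.
(* [P] may fail to be measurable, so the integral is estimated over the measurable set where [g] is
   at least [q], which contains [P] by [Pg]. *)
have mG : measurable ([set x | (q <= g x)%E] : set (Rn R m)).
  have -> : [set x | (q <= g x)%E] = setT `&` g @^-1` `[q, +oo[%classic.
    by rewrite setTI; apply/seteqP; split => x /=; rewrite in_itv/= andbT.
  by apply: mg => //; exact: emeasurable_itv.
apply: (@le_trans _ _ (\int[@lebesgue R m]_(x in setT) g x)%E).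
  apply: (@le_trans _ _ (\int[@lebesgue R m]_(x in [set x | (q <= g x)%E]) g x)%E); last first.
    by apply: ge0_subset_integral.
  apply: (@le_trans _ _ (\int[@lebesgue R m]_(x in [set x | (q <= g x)%E]) cst q x)%E);
    last first.
    apply: ge0_le_integral => //.
    - by move=> x _; exact: lebesgue_outer_ge0.
    - exact: measurable_funTS.
  rewrite integral_cst// muleC; apply: lee_wpmul2l; first exact: lebesgue_outer_ge0.
  by apply: le_lebesgue_outer => x /Pg.
rewrite (integral_nneseries _ measurableT mf (fun k x _ =>
  f0 k x)) esum_mkcond -nneseries_esumT; last first.
  by move=> k; case: ifP => // _; rewrite lee_fin box_volume_ge0.
apply: lee_nneseries => [k _ _|k _].
  by apply: integral_ge0.
rewrite (ge0_integralZl_EFin _ measurableT _ (mi k) (w0 k)); last first.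
  by move=> x _; rewrite lee_fin.
rewrite integral_indic// setIT /w; case: ifP => _; last by rewrite mul0e.
rewrite box_volume_rows EFinM muleC; apply: lee_wpmul2r.
  by rewrite lee_fin box_volume_ge0.
exact: lebesgue_outer_box_le.
Qed.

Lemma lebesgue_outer_rows_prod_null (R : realType) (m n : nat)
    (P : set 'rV[R]_m) (Q : set 'rV[R]_n) :
  lebesgue_outer P != 0%E -> lebesgue_outer Q != 0%E ->
  lebesgue_outer (rows_prod P Q) != 0%E.
Proof.
move=> P0 Q0; apply: contraTneq isT => PQ0.
have := lebesgue_outer_rows_prod_ge P Q; rewrite PQ0 leNgt mule_gt0//.
  by rewrite lt_neqAle eq_sym P0 lebesgue_outer_ge0.
by rewrite lt_neqAle eq_sym Q0 lebesgue_outer_ge0.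
Qed.

Lemma esumZl_ge0 (R : realType) (D : set nat) (a : nat -> \bar R) (c : R) :
  0 <= c -> (forall k, (0 <= a k)%E) ->
  (\esum_(k in D) (c%:E * a k) = c%:E * \esum_(k in D) a k)%E.
Proof.
move=> c0 a0; rewrite esum_mkcond [in RHS]esum_mkcond -!nneseries_esumT; first last.
- by move=> k; case: ifP => // _; rewrite mule_ge0.
- by move=> k; case: ifP.
rewrite -nneseriesZl; last by move=> k _; case: ifP.
by apply: eq_eseriesr => k _; case: ifP; rewrite ?mule0.
Qed.

Lemma lebesgue_outer_null_rows_boxr (R : realType) (m n : nat)
    (P : set 'rV[R]_m) (c : 'rV[R]_n * 'rV[R]_n) :
  lebesgue_outer P = 0%E -> lebesgue_outer (rows_prod P (box c)) = 0%E.
Proof.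
move=> P0; apply/eqP; rewrite eq_le lebesgue_outer_ge0 andbT.
apply/lee_addgt0Pr => e e0; rewrite add0e.
(* The summand 1 keeps the divisor positive when the box [c] is degenerate. *)
have v0 : 0 < box_volume c + 1 by rewrite ltr_wpDl// box_volume_ge0.
have [|D [B [PB sB]]] := @lebesgue_outer_lt_cover R m P (e / (box_volume c + 1))%:E.
  by rewrite P0 lte_fin divr_gt0.
apply: (@le_trans _ _ (\esum_(i in D) ((box_volume c)%:E * (box_volume (B i))%:E))%E).
  apply: ereal_inf_lbound; exists D, (fun i => (row_mx (B i).1 c.1, row_mx (B i).2 c.2)).
  split.
    move=> z [/PB[i Di Biz] cz]; exists i => //; rewrite box_rows_prod.
    by split; rewrite /lbox /rbox/= ?row_mxKl ?row_mxKr// -?surjective_pairing.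
  apply: eq_esum => i _; rewrite -EFinM box_volume_rows /lbox /rbox/= !row_mxKl !row_mxKr.
  by rewrite mulrC -!surjective_pairing.
rewrite esumZl_ge0 ?box_volume_ge0//; last by move=> k; rewrite lee_fin box_volume_ge0.
apply: (@le_trans _ _ ((box_volume c)%:E * (e / (box_volume c + 1))%:E)%E).
  by apply: lee_wpmul2l; [rewrite lee_fin box_volume_ge0|exact: ltW].
rewrite -EFinM lee_fin mulrCA ler_piMr ?(ltW e0)// ler_pdivrMr// mul1r lerDl.
exact: ler01.
Qed.

Lemma lebesgue_outer_null_rows_boxl (R : realType) (m n : nat)
    (c : 'rV[R]_m * 'rV[R]_m) (Q : set 'rV[R]_n) :
  lebesgue_outer Q = 0%E -> lebesgue_outer (rows_prod (box c) Q) = 0%E.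
Proof.
move=> Q0; apply/eqP; rewrite eq_le lebesgue_outer_ge0 andbT.
apply/lee_addgt0Pr => e e0; rewrite add0e.
have v0 : 0 < box_volume c + 1 by rewrite ltr_wpDl// box_volume_ge0.
have [|D [B [QB sB]]] := @lebesgue_outer_lt_cover R n Q (e / (box_volume c + 1))%:E.
  by rewrite Q0 lte_fin divr_gt0.
apply: (@le_trans _ _ (\esum_(i in D) ((box_volume c)%:E * (box_volume (B i))%:E))%E).
  apply: ereal_inf_lbound; exists D, (fun i => (row_mx c.1 (B i).1, row_mx c.2 (B i).2)).
  split.
    move=> z [cz /QB[i Di Biz]]; exists i => //; rewrite box_rows_prod.
    by split; rewrite /lbox /rbox/= ?row_mxKl ?row_mxKr// -?surjective_pairing.
  apply: eq_esum => i _; rewrite -EFinM box_volume_rows /lbox /rbox/= !row_mxKl !row_mxKr.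
  by rewrite -!surjective_pairing.
rewrite esumZl_ge0 ?box_volume_ge0//; last by move=> k; rewrite lee_fin box_volume_ge0.
apply: (@le_trans _ _ ((box_volume c)%:E * (e / (box_volume c + 1))%:E)%E).
  by apply: lee_wpmul2l; [rewrite lee_fin box_volume_ge0|exact: ltW].
rewrite -EFinM lee_fin mulrCA ler_piMr ?(ltW e0)// ler_pdivrMr// mul1r lerDl.
exact: ler01.
Qed.

Lemma cube_cover (R : realType) (n : nat) :
  [set: 'rV[R]_n] = \bigcup_k box (cube 0 k%:R).
Proof.
apply/seteqP; split => // x _.
pose k := (Num.truncn (\sum_i `|x 0 i|)).+1; exists k => //; apply/cubeP => i.
have : `|x 0 i| < k%:R.
  rewrite (le_lt_trans _ (truncnS_gt _))//.
  by rewrite (bigD1 i)//= lerDl sumr_ge0.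
rewrite mxE ltr_norml; move: (k%:R) (x 0 i) => a b /andP[? ?].
by apply/andP; split; lra.
Qed.

(** A null set times a bounded box is null by scaling the volumes of a cover; the unbounded other
    factor is covered by countably many cubes. *)
Lemma lebesgue_outer_null_rows_prod (R : realType) (m n : nat)
    (P : set 'rV[R]_m) (Q : set 'rV[R]_n) :
  lebesgue_outer P = 0%E \/ lebesgue_outer Q = 0%E ->
  lebesgue_outer (rows_prod P Q) = 0%E.
Proof.
case=> [P0|Q0].
  have : rows_prod P Q `<=` \bigcup_k rows_prod P (box (cube 0 k%:R)).
    move=> z [Pz _].
    have : [set: 'rV[R]_n] (rsubmx z) by []. rewrite cube_cover => -[k _ kz].
    by exists k.
  move=> /lebesgue_outer_null_subset; apply; apply: lebesgue_outer_null_bigcup => k.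
  exact: lebesgue_outer_null_rows_boxr.
have : rows_prod P Q `<=` \bigcup_k rows_prod (box (cube 0 k%:R)) Q.
  move=> z [_ Qz].
  have : [set: 'rV[R]_m] (lsubmx z) by []. rewrite cube_cover => -[k _ kz].
  by exists k.
move=> /lebesgue_outer_null_subset; apply; apply: lebesgue_outer_null_bigcup => k.
exact: lebesgue_outer_null_rows_boxl.
Qed.

(** In dimension 0 every box has volume 1, an empty product, and a cover of the only point uses at
    least one box. This starts the induction for [lebesgue_outer_box]. *)
Lemma lebesgue_outer_box0 (R : realType) (c : 'rV[R]_0 * 'rV[R]_0) :
  ((box_volume c)%:E <= lebesgue_outer (box c))%E.
Proof.
apply: le_ereal_inf_tmp => _ [D [B [cB ->]]].
have [|k Dk _] := cB c.1; first by case.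
have v1 (b : 'rV[R]_0 * 'rV[R]_0) : box_volume b = 1 by rewrite /box_volume big_ord0.
apply: (@le_trans _ _ (\esum_(i in [set k]) (box_volume (B i))%:E)%E).
  by rewrite esum_set1 ?lee_fin !v1.
rewrite esum_mkcond [leRHS]esum_mkcond; apply: le_esum => i _.
case: ifP => [|_]; first by rewrite inE => ->; rewrite mem_set.
by case: ifP => // _; rewrite v1.
Qed.

(** A cover is carried over to the real line, where the library's Lebesgue measure is countably
    subadditive and gives intervals their length. *)
Lemma lebesgue_outer_box1 (R : realType) (c : 'rV[R]_1 * 'rV[R]_1) :
  ((box_volume c)%:E <= lebesgue_outer (box c))%E.
Proof.
apply: le_ereal_inf_tmp => _ [D [B [cB ->]]].
have v1 (b : 'rV[R]_1 * 'rV[R]_1) :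
    lebesgue_measure (`]b.1 0 0, b.2 0 0]%classic : set R) = (box_volume b)%:E.
  rewrite lebesgue_measure_itv/= /box_volume big_ord1 lte_fin -EFinD.
  by rewrite /Order.max subr_gt0; case: ifP.
rewrite -v1 esum_mkcond -nneseries_esumT; last first.
  by move=> k; case: ifP => // _; rewrite lee_fin box_volume_ge0.
pose F k : set R := if k \in D then `](B k).1 0 0, (B k).2 0 0]%classic else set0.
apply: (@le_trans _ _ (\sum_(k <oo) lebesgue_measure (F k))%E).
  apply: measure_sigma_subadditive => //.
    by move=> k; rewrite /F; case: ifP => _.
  move=> x cx; have [|k Dk kx] := cB (const_mx x).
    by move=> i; rewrite mxE [i]ord1.
  by exists k => //; rewrite /F mem_set//; have := kx 0; rewrite mxE.
apply: lee_nneseries => // k _; rewrite /F; case: ifP => _; last by rewrite measure0.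
by rewrite v1.
Qed.

(** For the lower bound one coordinate is split off, and the product inequality multiplies the
    one-dimensional bound by the induction hypothesis. *)
Lemma lebesgue_outer_box (R : realType) (n : nat) (c : 'rV[R]_n * 'rV[R]_n) :
  lebesgue_outer (box c) = (box_volume c)%:E.
Proof.
apply/eqP; rewrite eq_le lebesgue_outer_box_le /=.
elim: n c => [|n IHn] c; first exact: lebesgue_outer_box0.
rewrite -[n.+1]/(1 + n)%N in c *.
rewrite box_rows_prod box_volume_rows EFinM.
apply: le_trans (lebesgue_outer_rows_prod_ge _ _).
by apply: lee_pmul; rewrite ?lee_fin ?box_volume_ge0//; exact: lebesgue_outer_box1.
Qed.

(** * Lebesgue's density theorem *)

Lemma lebesgue_outer_cover_le (R : realType) (n : nat) (A : set 'rV[R]_n)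
    (D : set nat) (B : nat -> 'rV[R]_n * 'rV[R]_n) :
  A `<=` \bigcup_(k in D) box (B k) ->
  (lebesgue_outer A <= \esum_(k in D) (box_volume (B k))%:E)%E.
Proof. by move=> AB; apply: ereal_inf_lbound; exists D, B. Qed.

Lemma box_volume_enlarge (R : realType) (n : nat) (c : 'rV[R]_n * 'rV[R]_n) (e : R) :
  0 < e -> exists2 d, 0 < d &
  box_volume (c.1, c.2 + const_mx d) < box_volume c + e.
Proof.
move=> e0.
have cf : continuous (fun d : R => box_volume (c.1, c.2 + const_mx d)).
  rewrite /box_volume /=; elim: (index_enum _) => [|i s IHs].
    by under eq_fun do rewrite big_nil; move=> x; exact: cvg_cst.
  under eq_fun do rewrite big_cons.
  suff h : continuous (fun d : R => Num.max 0 ((c.2 + const_mx d) 0 i - c.1 0 i)).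
    by move=> x; exact: (cvgM (h x) (IHs x)).
  (* With the positive part written through the absolute value, continuity follows from that of the
     norm. *)
  have -> : (fun d : R => Num.max 0 ((c.2 + const_mx d) 0 i - c.1 0 i)) =
      (fun d => (c.2 0 i + d - c.1 0 i + `|c.2 0 i + d - c.1 0 i|) / 2).
    by apply/funext => d; rewrite !mxE maxr_absE add0r sub0r normrN.
  move=> x.
  have cd : (fun d : R => c.2 0 i + d - c.1 0 i) @ x --> c.2 0 i + x - c.1 0 i.
    by apply: cvgB; [apply: cvgD; [exact: cvg_cst|exact: cvg_id]|exact: cvg_cst].
  exact: (cvgM (cvgD cd (cvg_norm cd)) (cvg_cst _)).
have : \forall d \near (0:R)^'+, box_volume (c.1, c.2 + const_mx d) < box_volume c + e.
  have := cvg_at_right_filter (cf 0).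
  rewrite (_ : box_volume (c.1, c.2 + const_mx 0) = box_volume c); last first.
    by congr box_volume; case: c {cf} => a b /=; congr pair; apply/rowP => i;
      rewrite !mxE addr0.
  by move=> /cvgr_lt; apply; rewrite ltrDl.
move=> h; near (0:R)^'+ => d; exists d; near: d => //; exact: nbhs_right_gt.
Unshelve. all: by end_near. Qed.

(** Outer regularity. Pushing out the upper faces of a half-open box puts it into the interior of
    the enlarged box, the lower faces being excluded already. Half of [e] pays for the choice of the
    cover, the other half, split geometrically, for the enlargements. *)
Lemma lebesgue_outer_open_cover (R : realType) (n : nat) (A : set 'rV[R]_n) (e : R) :
  (lebesgue_outer A < +oo)%E -> 0 < e ->
  exists U, [/\ open U, A `<=` U & (lebesgue_outer U <= lebesgue_outer A + e%:E)%E].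
Proof.
move=> Afin e0; have e20 : 0 < e / 2 by rewrite divr_gt0.
have [|D [B [AB sB]]] := @lebesgue_outer_lt_cover R n A (lebesgue_outer A + (e / 2)%:E)%E.
  by rewrite lteDl// ge0_fin_numE// lebesgue_outer_ge0.
have /choice[d dP] : forall k, exists d, 0 < d /\
    box_volume ((B k).1, (B k).2 + const_mx d) < box_volume (B k) + e / 2 / (2 ^ k.+1)%:R.
  move=> k; have [|d d0 dk] := @box_volume_enlarge R n (B k) (e / 2 / (2 ^ k.+1)%:R).
    by rewrite divr_gt0// ltr0n expn_gt0.
  by exists d.
pose B' k := ((B k).1, (B k).2 + const_mx (d k)).
exists (\bigcup_(k in D) box (B' k))^°; split; first exact: open_interior.
  move=> x /AB[k Dk kx].
  have : \forall y \near x, box (B' k) y.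
    apply: (@filter_forall _ _
      (fun i => [set y : 'rV[R]_n | y 0 i \in `](B' k).1 0 i, (B' k).2 0 i]]) (nbhs x) _) =>
        i; have := kx i; rewrite in_itv/= => /andP[x1 x2].
    have cx := @coord_continuous R 1 n 0 i x.
    have h1 : nbhs x [set y : 'rV[R]_n | (B k).1 0 i < y 0 i] by exact: (cvgr_gt _ cx).
    have h2 : nbhs x [set y : 'rV[R]_n | y 0 i < (B k).2 0 i + d k].
      by apply: (cvgr_lt _ cx); rewrite (le_lt_trans x2)// ltrDl (dP k).1.
    apply: filterS2 h1 h2 => y /= y1 y2; rewrite in_itv/= !mxE y1; exact: ltW.
  by apply: filterS => y By; exists k.
apply: (@le_trans _ _ (lebesgue_outer (\bigcup_(k in D) box (B' k)))).
  by apply: le_lebesgue_outer; exact: interior_subset.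
apply: (le_trans (@lebesgue_outer_cover_le _ _ _ D B' (@subset_refl _ _))).
apply: (@le_trans _ _ (\sum_(k <oo) ((if k \in D then (box_volume (B k))%:E else 0)
    + (e / 2 / (2 ^ k.+1)%:R)%:E))%E).
  rewrite esum_mkcond -nneseries_esumT; last first.
    by move=> k; case: ifP => // _; rewrite lee_fin box_volume_ge0.
  apply: lee_nneseries => [k _ _|k _]; case: ifP => _ //.
  - by rewrite lee_fin box_volume_ge0.
  - by rewrite -EFinD lee_fin ltW// (dP k).2.
  - by rewrite add0e lee_fin divr_ge0// ltW.
apply: (le_trans (epsilon_trick _ _ _)) => [k||].
- by case: ifP => // _; rewrite lee_fin box_volume_ge0.
- exact: ltW.
rewrite nneseries_esumT; last by move=> k; case: ifP => // _; rewrite lee_fin box_volume_ge0.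
rewrite -esum_mkcond [leRHS](_ : _ = lebesgue_outer A + (e / 2)%:E + (e / 2)%:E)%E.
  by rewrite leeD2r// ltW.
by rewrite -addeA -EFinD -splitr.
Unshelve. all: by end_near. Qed.

(** Zorn's lemma is applied to the disjoint subfamilies [D] such that every ball of [V] meeting [D]
    meets a member with at least half its radius. Unions of chains keep this property, and a maximal
    such family must meet every ball of [V]. *)
Lemma vitali_covering (R : realType) (T : pseudoMetricType R) (V : set (T * R)) :
  (forall p, V p -> 0 < p.2 <= 1) ->
  exists D : set (T * R), [/\ D `<=` V, trivIset D (fun p => ball p.1 p.2) &
    forall p, V p -> exists q,
      [/\ D q, ball p.1 p.2 `&` ball q.1 q.2 !=set0 & p.2 <= 2 * q.2]].
Proof.
move=> V01.
pose meets (p q : T * R) := ball p.1 p.2 `&` ball q.1 q.2 !=set0.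
pose P := [set D : set (T * R) | [/\ D `<=` V, trivIset D (fun p => ball p.1 p.2) &
  forall p, V p -> (exists2 q, D q & meets p q) ->
    exists q, [/\ D q, meets p q & p.2 <= 2 * q.2]]].
have [F FP tF|A [[AV tA mA] maxA]] := @Zorn_bigcup _ P.
  split.
  - by move=> p [D /FP[DV _ _] /DV].
  - move=> p q [D FD Dp] [D' FD' Dq].
    have [DD'|D'D] := tF _ _ FD FD'.
      by have [_ tD _] := FP _ FD'; apply: tD => //; exact: DD'.
    by have [_ tD _] := FP _ FD; apply: tD => //; exact: D'D.
  - move=> p Vp [q [D FD Dq] pq].
    have [_ _ /(_ p Vp)[]] := FP _ FD; first by exists q.
    by move=> q' [Dq' ? ?]; exists q'; split=> //; exists D.
exists A; split=> // p Vp; have [|nAp] := pselect (exists2 q, A q & meets p q).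
  exact: mA.
exfalso.
pose V' := [set p | V p /\ ~ exists2 q, A q & meets p q].
have hs : has_sup [set p.2 | p in V'].
  split; first by exists p.2, p.
  by exists 1 => _ [q [/V01/andP[]] _ ? _ <-].
have p0 : 0 < p.2 by have /andP[] := V01 _ Vp.
have s0 : 0 < sup [set p.2 | p in V'].
  by rewrite (lt_le_trans p0)//; apply: ub_le_sup; [exact: hs.2|exists p].
(* Among the balls of [V] that miss [A], [q] has more than half the supremal radius. A ball missing
   [A] but meeting [q] then has radius at most twice that of [q], so [q] can be added to [A],
   against maximality. *)
have [|_ [q [Vq nAq] <-] sq] := @sup_adherent R _ (sup [set p.2 | p in V'] / 2) _ hs.
  by rewrite divr_gt0.
have /andP[q0 _] := V01 _ Vq.
apply: (maxA (A `|` [set q])).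
  split; first by left.
  move=> /(_ q (or_intror erefl)) Aq; apply: nAq; exists q => //.
  by exists q.1; split; exact: ballxx.
split.
- by move=> r [/AV//|->].
- move=> a b [Aa|->] [Ab|->]// ab; first exact: tA.
    by exfalso; apply: nAq; exists a => //; rewrite /meets setIC.
  by exfalso; apply: nAq; exists b.
move=> r Vr [a Aa ra].
have [/mA[//|b [? ? ?]]|nAr] := pselect (exists2 q, A q & meets r q).
  by exists b; split => //; left.
case: Aa => [Aa|aq]; first by exfalso; apply: nAr; exists a.
exists q; split; [by right|by rewrite -aq|].
have : r.2 <= sup [set p.2 | p in V'] by apply: ub_le_sup; [exact: hs.2|exists r].
by move: sq; move: (sup _) => s; lra.
Qed.

(** Each selected ball contains a rational point and disjoint balls contain different ones, so the
    codes of these points index the family by natural numbers. *)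
Lemma vitali_covering_rV (R : realType) (n : nat) (V : set ('rV[R]_n * R)) :
  (forall p, V p -> 0 < p.2 <= 1) ->
  exists (N : set nat) (g : nat -> 'rV[R]_n * R),
    [/\ forall k, N k -> V (g k), trivIset N (fun k => ball (g k).1 (g k).2) &
    forall p, V p -> exists k,
      [/\ N k, ball p.1 p.2 `&` ball (g k).1 (g k).2 !=set0 & p.2 <= 2 * (g k).2]].
Proof.
move=> V01; have [D [DV tD cD]] := vitali_covering V01.
have /choice[q qP] : forall p : 'rV[R]_n * R, exists q : 'rV[rat]_n,
    D p -> ball p.1 p.2 (map_mx ratr q).
  move=> p; have [Dp|] := pselect (D p); last by exists 0.
  have /andP[p0 _] := V01 _ (DV _ Dp).
  have [q qP] := rat_vector_near p.1 p0.
  by exists q => _; apply/ballP_rV => // i; rewrite mxE.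
pose N := [set k | exists2 p, D p & pickle (q p) = k].
have /choice[g gP] : forall k, exists p, N k -> D p /\ pickle (q p) = k.
  move=> k; have [[p Dp pk]|] := pselect (N k); last by exists (0, 0).
  by exists p.
exists N, g; split.
- by move=> k /gP[/DV].
- move=> k l Nk Nl kl.
  have [[Dk <-] [Dl <-]] := (gP _ Nk, gP _ Nl).
  by congr (pickle (q _)); apply: tD.
- move=> p /cD[r [Dr pr rp]]; exists (pickle (q r)).
  have Nr : N (pickle (q r)) by exists r.
  have [Dg /(pcan_inj pickleK) qg] := gP _ Nr.
  suff -> : g (pickle (q r)) = r by [].
  apply: tD => //; exists (map_mx ratr (q r)); split; last exact: qP.
  by have := qP _ Dg; rewrite qg.
Qed.

Lemma box_volume_cube (R : realType) (n : nat) (x : 'rV[R]_n) (r : R) :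
  0 <= r -> box_volume (cube x r) = (2 * r) ^+ n.
Proof.
move=> r0; rewrite /box_volume /=.
under eq_bigr => i _.
  rewrite !mxE (_ : x 0 i + r - (x 0 i - r) = 2 * r); last by ring.
  rewrite max_r ?mulr_ge0//; over.
by rewrite prodr_const card_ord.
Qed.

Lemma ball_sub_cube (R : realType) (n : nat) (x : 'rV[R]_n) (r : R) :
  ball x r `<=` box (cube x r).
Proof.
move=> y xy; apply/cubeP => i; case: xy => _ /(_ 0 i).
by rewrite /ball/= ltr_norml => /andP[? ?]; apply/andP; split; lra.
Qed.

Lemma lebesgue_outer_ball_lty (R : realType) (n : nat) (x : 'rV[R]_n) (r : R) :
  (lebesgue_outer (ball x r) < +oo)%E.
Proof.
rewrite (le_lt_trans (le_lebesgue_outer (@ball_sub_cube _ _ _ _)))//.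
by rewrite lebesgue_outer_box ltry.
Qed.

Lemma ball_measurable (R : realType) (n : nat) (x : 'rV[R]_n) (r : R) :
  measurable (ball x r : set (Rn R n)).
Proof. by apply: open_measurable_rV; exact: ball_open. Qed.

(** In an open [U] exceeding [E] by little measure, disjoint balls are selected whose threefold
    enlargements cover [Z]. Each ball holds a fixed proportion of points of [U] outside [E], so the
    total volume is at most a constant times the small measure of that excess. *)
Lemma density_null_fin (R : realType) (n : nat) (E Z : set 'rV[R]_n) (c : R) :
  measurable (E : set (Rn R n)) -> (lebesgue_outer E < +oo)%E -> Z `<=` E -> 0 < c ->
  (forall x, Z x -> forall d, 0 < d -> exists2 r, 0 < r < d &
    ((c * r ^+ n)%:E <= lebesgue_outer (ball x r `\` E))%E) ->
  lebesgue_outer Z = 0%E.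
Proof.
move=> mE Efin ZE c0 Zc.
apply/eqP; rewrite eq_le lebesgue_outer_ge0 andbT.
apply/lee_addgt0Pr => e e0; rewrite add0e.
(* A cube of half-side 3 r has volume (6 r)^n, that is [C] times the measure c r^n guaranteed
   outside [E]. *)
pose C := 6 ^+ n / c; have C0 : 0 < C by rewrite divr_gt0// exprn_gt0.
have eC0 : 0 < e / C by rewrite divr_gt0.
have [U [oU EU UE]] := lebesgue_outer_open_cover Efin eC0.
have mU : measurable (U : set (Rn R n)) by exact: open_measurable_rV.
have UDE : (lebesgue_outer (U `\` E) <= (e / C)%:E)%E.
  move: UE; rewrite (mE U) (_ : U `&` E = E); last by apply/setIidPr.
  by rewrite leeD2lE// ge0_fin_numE// lebesgue_outer_ge0.
pose V := [set p : 'rV[R]_n * R | [/\ Z p.1, 0 < p.2 <= 1, ball p.1 p.2 `<=` U &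
  ((c * p.2 ^+ n)%:E <= lebesgue_outer (ball p.1 p.2 `\` E))%E]].
have [|N [g [gV tg cg]]] := @vitali_covering_rV R n V; first by move=> p [].
have Zcov : Z `<=` \bigcup_(k in N) box (cube (g k).1 (3 * (g k).2)).
  move=> x Zx.
  have /nbhs_ballP[s /= s0 xsU] := open_nbhs_nbhs (conj oU (EU _ (ZE _ Zx))).
  have [|r /andP[r0]] := Zc x Zx (Num.min s 1); first by rewrite lt_min s0/=.
  rewrite lt_min => /andP[rs r1] cr.
  have Vp : V (x, r).
    split=> //=; first by rewrite r0 ltW.
    by apply: subset_trans xsU; apply: le_ball; exact: ltW.
  have [k [Nk [y [/= xy gy]] rg]] := cg _ Vp.
  exists k => //; apply: ball_sub_cube.
  (* Only the centre [x] has to be covered, so 1 + 2 suffices as factor: [x] is within [r] of a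
     point of the selected ball, and [r] is at most twice the radius of that ball. *)
  have -> : 3 * (g k).2 = (g k).2 + 2 * (g k).2 by ring.
  apply: ball_triangle gy _; apply: ball_sym; apply: le_ball xy => //.
apply: (le_trans (lebesgue_outer_cover_le Zcov)).
apply: (@le_trans _ _ (\esum_(k in N)
    (C%:E * lebesgue_outer (ball (g k).1 (g k).2 `\` E)))%E).
  apply: le_esum => k /gV[_ /andP[r0 _] _ cr].
  rewrite box_volume_cube ?mulr_ge0 ?(ltW r0)//.
  apply: (@le_trans _ _ (C%:E * (c * (g k).2 ^+ n)%:E)%E); last first.
    by apply: lee_wpmul2l => //; rewrite lee_fin ltW.
  rewrite -EFinM lee_fin [leRHS](_ : _ = (2 * (3 * (g k).2)) ^+ n)//.
  rewrite (mulrA C) /C divfK ?gt_eqF// -exprMn; congr (_ ^+ _); ring.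
rewrite esumZl_ge0 ?(ltW C0)//; last by move=> k; exact: lebesgue_outer_ge0.
apply: (@le_trans _ _ (C%:E * (e / C)%:E)%E); last first.
  by rewrite -EFinM mulrC divfK ?gt_eqF.
apply: lee_wpmul2l; first by rewrite lee_fin ltW.
apply: le_trans UDE.
have mB k : measurable ((ball (g k).1 (g k).2 `\` E) : set (Rn R n)).
  by apply: measurableD => //; exact: ball_measurable.
apply: (@le_trans _ _ (@lebesgue R n (\bigcup_(k in N) (ball (g k).1 (g k).2 `\` E)))).
  rewrite measure_bigcup//; last first.
    by move=> k l Nk Nl [y [[? _] [? _]]]; apply: tg => //; exists y.
  by rewrite nneseries_esum// set_mem_set.
by apply: le_lebesgue_outer => x [k /gV[_ _ gU _] [/gU ? ?]].
Qed.

(** Intersecting [E] with a ball only enlarges what lies outside it, so the hypothesis on small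
    balls passes to the bounded pieces. *)
Lemma density_null (R : realType) (n : nat) (E Z : set 'rV[R]_n) (c : R) :
  measurable (E : set (Rn R n)) -> Z `<=` E -> 0 < c ->
  (forall x, Z x -> forall d, 0 < d -> exists2 r, 0 < r < d &
    ((c * r ^+ n)%:E <= lebesgue_outer (ball x r `\` E))%E) ->
  lebesgue_outer Z = 0%E.
Proof.
move=> mE ZE c0 Zc.
have : Z `<=` \bigcup_k (Z `&` ball 0 k.+1%:R).
  move=> x Zx; exists (Num.truncn `|x|) => //; split => //.
  by rewrite -ball_normE/= sub0r normrN truncnS_gt.
move=> /lebesgue_outer_null_subset; apply; apply: lebesgue_outer_null_bigcup => k.
apply: (@density_null_fin _ _ (E `&` ball 0 k.+1%:R) _ c) => //.
- by apply: measurableI => //; exact: ball_measurable.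
- apply: le_lt_trans (lebesgue_outer_ball_lty 0 k.+1%:R).
  by apply: le_lebesgue_outer => x [].
- by move=> x [/ZE].
move=> x [Zx xk] d d0.
have [r rd rc] := Zc x Zx d d0; exists r => //.
apply: (le_trans rc); apply: le_lebesgue_outer => y [? nEy]; split=> //.
by case.
Qed.

(** * Euclidean balls and density points *)

Lemma euclidean_ball_sub (R : realType) (n : nat) (x : 'rV[R]_n) (r : R) : 0 < r ->
  euclidean_ball x r `<=` ball x r.
Proof.
move=> r0 y /= xy; apply/ballP_rV => // i.
rewrite distrC -sqrtr_sqr (le_lt_trans _ xy)// ler_sqrt ?sumr_ge0//; last first.
  by move=> j _; exact: sqr_ge0.
by rewrite (bigD1 i)//= lerDl sumr_ge0// => j _; exact: sqr_ge0.
Qed.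

(** The divisor [n.+1] works in every dimension, 0 included, because n / (n+1)^2 is below 1. *)
Lemma ball_sub_euclidean (R : realType) (n : nat) (x : 'rV[R]_n) (r : R) : 0 < r ->
  ball x (r / n.+1%:R) `<=` euclidean_ball x r.
Proof.
move=> r0 y /ballP_rV xy; rewrite /euclidean_ball/=.
have d0 : 0 < r / n.+1%:R by rewrite divr_gt0.
rewrite [ltRHS](_ : r = Num.sqrt (r ^+ 2)); last by rewrite sqrtr_sqr gtr0_norm.
rewrite ltr_sqrt ?exprn_gt0//.
apply: (@le_lt_trans _ _ (\sum_(i < n) (r / n.+1%:R) ^+ 2)).
  apply: ler_sum => i _;
    rewrite -[leLHS]real_normK ?num_real// distrC lerXn2r// ?nnegrE// ?ltW//.
  exact: xy.
rewrite sumr_const card_ord expr_div_n -(mulr_natl _ n) mulrCA gtr_pMr ?exprn_gt0//.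
rewrite ltr_pdivrMr ?exprn_gt0// mul1r -natrX ltr_nat.
by rewrite (leq_trans (ltnSn n))// -[leqLHS]expn1 leq_pexp2l.
Qed.

Lemma lebesgue_outer_ball_ge (R : realType) (n : nat) (x : 'rV[R]_n) (r : R) :
  0 < r -> ((r ^+ n)%:E <= lebesgue_outer (ball x r))%E.
Proof.
move=> r0; have {1}-> : r = 2 * (r / 2) by rewrite [RHS]mulrC divfK.
rewrite -(@box_volume_cube _ _ x); last by rewrite divr_ge0// ltW.
rewrite -lebesgue_outer_box; apply: le_lebesgue_outer => y xy.
apply/ballP_rV => // i; move/cubeP : xy => /(_ i).
move: (x 0 i) (y 0 i) => a b /andP[? ?].
by rewrite ltr_norml; apply/andP; split; lra.
Qed.

Lemma lebesgue_euclidean_ball_ge (R : realType) (n : nat) (x : 'rV[R]_n) (r : R) :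
  0 < r -> (((r / n.+1%:R) ^+ n)%:E <= lebesgue_outer (euclidean_ball x r))%E.
Proof.
move=> r0; apply: le_trans (lebesgue_outer_ball_ge x (divr_gt0 r0 (ltr0Sn _ n))) _.
exact/le_lebesgue_outer/ball_sub_euclidean.
Qed.

Lemma lebesgue_euclidean_ball_lty (R : realType) (n : nat) (x : 'rV[R]_n) (r : R) :
  0 < r -> (lebesgue_outer (euclidean_ball x r) < +oo)%E.
Proof.
move=> r0; apply: le_lt_trans (lebesgue_outer_ball_lty x r).
exact/le_lebesgue_outer/euclidean_ball_sub.
Qed.

Definition density_ratio (R : realType) (n : nat) (A : set 'rV[R]_n) x (r : R) :=
  fine (lebesgue (A `&` euclidean_ball x r)) / fine (lebesgue (euclidean_ball x r)).

Lemma density_ratioE (R : realType) (n : nat) (A : set 'rV[R]_n) x (r : R) : 0 < r ->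
  lebesgue_outer (A `&` euclidean_ball x r) =
  ((density_ratio A x r)%:E * lebesgue_outer (euclidean_ball x r))%E.
Proof.
move=> r0; have Bfin := lebesgue_euclidean_ball_lty x r0.
have B0 : (0 < lebesgue_outer (euclidean_ball x r))%E.
  apply: lt_le_trans (lebesgue_euclidean_ball_ge x r0).
  by rewrite lte_fin exprn_gt0// divr_gt0.
have Afin : (lebesgue_outer (A `&` euclidean_ball x r) < +oo)%E.
  by apply: le_lt_trans Bfin; apply: le_lebesgue_outer => y [].
rewrite /density_ratio /lebesgue.
rewrite -[X in (_ * X)%E]fineK ?ge0_fin_numE ?lebesgue_outer_ge0//.
rewrite -EFinM divfK ?fineK ?ge0_fin_numE ?lebesgue_outer_ge0//.
by rewrite gt_eqF// fine_gt0// B0.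
Qed.

Lemma density_ratio_le1 (R : realType) (n : nat) (A : set 'rV[R]_n) x (r : R) : 0 < r ->
  density_ratio A x r <= 1.
Proof.
move=> r0; have Bfin := lebesgue_euclidean_ball_lty x r0.
have B0 : (0 < lebesgue_outer (euclidean_ball x r))%E.
  apply: lt_le_trans (lebesgue_euclidean_ball_ge x r0).
  by rewrite lte_fin exprn_gt0// divr_gt0.
rewrite /density_ratio ler_pdivrMr ?fine_gt0 ?B0// mul1r fine_le//.
- rewrite ge0_fin_numE ?lebesgue_outer_ge0//.
  by apply: le_lt_trans Bfin; apply: le_lebesgue_outer => y [].
- by rewrite ge0_fin_numE ?lebesgue_outer_ge0.
- by apply: le_lebesgue_outer => y [].
Qed.

Lemma density_points_near (R : realType) (n : nat) (A : set 'rV[R]_n) x (d : R) :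
  density_points A x -> 0 < d -> exists2 r, 0 < r < d &
  (((r / n.+1%:R) ^+ n / 2)%:E <= lebesgue_outer (A `&` euclidean_ball x r))%E.
Proof.
move=> Ax d0.
have near12 : \forall r \near (0:R)^'+, 1 / 2 < density_ratio A x r.
  by apply: (cvgr_gt _ Ax); lra.
near (0:R)^'+ => r.
have r0 : 0 < r by near: r; exact: nbhs_right_gt.
exists r; first by rewrite r0/=; near: r; exact: nbhs_right_lt.
rewrite density_ratioE//; apply: (@le_trans _ _ ((1 / 2)%:E * ((r / n.+1%:R) ^+ n)%:E)%E).
  by rewrite -EFinM lee_fin mul1r mulrC.
apply: lee_pmul.
- by rewrite lee_fin.
- by rewrite lee_fin exprn_ge0// divr_ge0// ltW.
- by rewrite lee_fin; apply: ltW; near: r.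
- exact: lebesgue_euclidean_ball_ge.
Unshelve. all: by end_near. Qed.

Lemma density_points_ball (R : realType) (n : nat) (A : set 'rV[R]_n) x (d : R) :
  density_points A x -> 0 < d -> lebesgue_outer (A `&` ball x d) != 0%E.
Proof.
move=> Ax d0; have [r /andP[r0 rd] rA] := density_points_near Ax d0.
rewrite gt_eqF//; apply: (@lt_le_trans _ _ ((r / n.+1%:R) ^+ n / 2)%:E).
  by rewrite lte_fin divr_gt0// exprn_gt0// divr_gt0.
apply: (le_trans rA); apply: le_lebesgue_outer => y [Ay /(euclidean_ball_sub r0) xy].
by split=> //; apply: le_ball xy; exact: ltW.
Qed.

(** [density_null] is applied to the complement of [E]: arbitrarily small balls at a density point
    of [E] contain a fixed proportion of [E], hence of points outside that complement. *)
Lemma density_points_sub (R : realType) (n : nat) (E : set 'rV[R]_n) :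
  measurable (E : set (Rn R n)) -> lebesgue_outer (density_points E `\` E) = 0%E.
Proof.
move=> mE; have c0 : 0 < (n.+1%:R^-1) ^+ n / 2 :> R by rewrite divr_gt0// exprn_gt0.
apply: (@density_null _ _ (~` E) _ _ _ _ c0).
- exact: measurableC.
- by move=> x [].
move=> x [Ex _] d d0; have [r /andP[r0 rd] rE] := density_points_near Ex d0.
exists r; first by rewrite r0.
apply: le_trans (le_trans rE _).
  by rewrite lee_fin exprMn mulrC mulrA.
apply: le_lebesgue_outer => y [Ey /(euclidean_ball_sub r0) xy].
by split=> // /(_ Ey).
Qed.

(** If density 1 fails at a point, then for some k the ratio is at most 1 - 1/(k+1) for arbitrarily
    small radii. For fixed k the complement of [E] fills the proportion 1/(k+1) of these balls, and
    [density_null] applies. *)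
Lemma sub_density_points (R : realType) (n : nat) (E : set 'rV[R]_n) :
  measurable (E : set (Rn R n)) -> lebesgue_outer (E `\` density_points E) = 0%E.
Proof.
move=> mE.
pose Z k := [set x | E x /\ forall d, 0 < d -> exists2 r, 0 < r < d &
  density_ratio E x r <= 1 - k.+1%:R^-1].
have : E `\` density_points E `<=` \bigcup_k Z k.
  move=> x [Ex nEx]; apply: contrapT => nZ; apply: nEx.
  apply/cvgrPdist_le => e e0.
  have [k ke] : exists k, k.+1%:R^-1 < e.
    near \oo => k; exists k; near: k.
    exact: (near_infty_natSinv_lt (PosNum e0)).
  have nZk : ~ Z k x by move=> Zk; apply: nZ; exists k.
  have [d d0 dk] : exists2 d, 0 < d & forall r,
    0 < r < d -> 1 - k.+1%:R^-1 < density_ratio E x r.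
    apply: contrapT => nd; apply: nZk; split=> // d d0.
    apply: contrapT => nr; apply: nd; exists d => // r rd.
    by rewrite ltNge; apply/negP => ?; apply: nr; exists r.
  near=> r.
  have r0 : 0 < r by near: r; exact: nbhs_right_gt.
  have rd : r < d by near: r; exact: nbhs_right_lt.
  have := dk r; rewrite r0 rd => /(_ isT); have := density_ratio_le1 E x r0.
  rewrite /density_ratio; move: (_ / _) ke => u; move: (_^-1) => v ke u1 uv.
  by rewrite ger0_norm; lra.
move=> /lebesgue_outer_null_subset; apply; apply: lebesgue_outer_null_bigcup => k.
have c0 : 0 < k.+1%:R^-1 * (n.+1%:R^-1) ^+ n :> R by rewrite mulr_gt0// exprn_gt0.
apply: (@density_null _ _ E _ _ _ _ c0) => //; first by move=> x [].
move=> x [Ex Zx] d d0; have [r /andP[r0 rd] rE] := Zx _ d0.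
exists r; first by rewrite r0.
apply: (@le_trans _ _ (lebesgue_outer (euclidean_ball x r `\` E))); last first.
  by apply: le_lebesgue_outer => y [/(euclidean_ball_sub r0) xy].
have BE : (lebesgue_outer (euclidean_ball x r) =
    (density_ratio E x r)%:E * lebesgue_outer (euclidean_ball x r) +
    lebesgue_outer (euclidean_ball x r `\` E))%E.
  by rewrite -density_ratioE// setIC; exact: mE.
move: BE rE (lebesgue_euclidean_ball_ge x r0) (lebesgue_euclidean_ball_lty x r0).
move: (lebesgue_outer_ge0 (euclidean_ball x r)) (lebesgue_outer_ge0 (euclidean_ball x r `\` E)).
move: (lebesgue_outer _) (lebesgue_outer _) => [a| |]// [b| |]// a0 b0.
rewrite -EFinM -EFinD !lee_fin => -[ba] rE bge _.
have -> : k.+1%:R^-1 * n.+1%:R^-1 ^+ n * r ^+ n = k.+1%:R^-1 * (r / n.+1%:R) ^+ n.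
  by rewrite -mulrA -exprMn (mulrC r).
rewrite lee_fin in b0; apply: (@le_trans _ _ (k.+1%:R^-1 * b)).
  by rewrite ler_wpM2l.
have : density_ratio E x r * b <= (1 - k.+1%:R^-1) * b by apply: ler_wpM2r.
by move: ba; move: (density_ratio _ _ _ * b) (_^-1) => u v; rewrite mulrBl mul1r; lra.
Unshelve. all: by end_near. Qed.

(** * Gauges and Minkowski sums *)

Lemma convex_body_conv (R : realType) (n : nat) (K : set 'rV[R]_n) (a : R) x y :
  convex_body_o K -> 0 <= a <= 1 -> K x -> K y -> K (a *: x + (1 - a) *: y).
Proof.
move=> [_ cK _] a01 Kx Ky.
have := cK x y (Itv01 (andP a01).1 (andP a01).2) (mem_set Kx) (mem_set Ky).
by rewrite inE.
Qed.

Lemma convex_body0 (R : realType) (n : nat) (K : set 'rV[R]_n) :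
  convex_body_o K -> K 0.
Proof. by move=> [_ _ /interior_subset]. Qed.

Lemma convex_body_absorbing (R : realType) (n : nat) (K : set 'rV[R]_n) :
  convex_body_o K -> exists2 C, 0 < C & forall x (l : R), C * `|x| < l -> dilate l K x.
Proof.
move=> [_ _ /nbhs_ballP[e /= e0 eK]].
exists e^-1; first by rewrite invr_gt0.
move=> x l xl; have l0 : 0 < l by rewrite (le_lt_trans _ xl)// mulr_ge0// invr_ge0 ltW.
exists (l^-1 *: x); last by rewrite scalerA mulfV ?gt_eqF// scale1r.
apply: eK; rewrite -ball_normE/= sub0r normrN normrZ gtr0_norm ?invr_gt0//.
by rewrite mulrC ltr_pdivrMr// -ltr_pdivrMl.
Qed.

Lemma dilate_mono (R : realType) (n : nat) (K : set 'rV[R]_n) (l m : R) :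
  convex_body_o K -> 0 <= l <= m -> dilate l K `<=` dilate m K.
Proof.
move=> hK /andP[l0]; rewrite le_eqVlt => /predU1P[-> //|lm] _ [k Kk <-].
have m0 : 0 < m by exact: le_lt_trans lm.
exists ((l / m) *: k); last by rewrite scalerA mulrC divfK// gt_eqF.
rewrite -[_ *: _]addr0 -(scaler0 _ (1 - l / m)).
apply: convex_body_conv => //; last exact: convex_body0.
by rewrite divr_ge0// ?(ltW m0)//= ler_pdivrMr// mul1r ltW.
Qed.

Lemma gauge_has_inf (R : realType) (n : nat) (K : set 'rV[R]_n) x :
  convex_body_o K -> has_inf [set l : R | 0 <= l /\ dilate l K x].
Proof.
move=> hK; split; last by exists 0 => l [].
have [C C0 CK] := convex_body_absorbing hK.
exists (C * `|x| + 1); split; first by rewrite addr_ge0// mulr_ge0// ltW.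
by apply: CK; rewrite ltrDl.
Qed.

Lemma gauge_ge0 (R : realType) (n : nat) (K : set 'rV[R]_n) x :
  convex_body_o K -> 0 <= gauge K x.
Proof.
by move=> hK; apply: lb_le_inf; [exact: (gauge_has_inf x hK).1|move=> l []].
Qed.

Lemma gauge_le (R : realType) (n : nat) (K : set 'rV[R]_n) x (l : R) :
  0 <= l -> dilate l K x -> gauge K x <= l.
Proof. by move=> l0 lx; apply: ge_inf => //; exists 0 => m []. Qed.

Lemma gauge_lt (R : realType) (n : nat) (K : set 'rV[R]_n) x (l : R) :
  convex_body_o K -> gauge K x < l -> dilate l K x.
Proof.
move=> hK xl; have [|m [m0 mx] ml] := @inf_adherent _ _ (l - gauge K x) _ (gauge_has_inf x hK).
  by rewrite subr_gt0.
rewrite -/(gauge K x) addrC subrK in ml.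
by apply: dilate_mono mx => //; rewrite m0 ltW.
Qed.

(** The infimum is attained: x/m lies in [K] for every m > l and tends to x/l as m decreases to l,
    and [K] is closed. *)
Lemma gauge_leP (R : realType) (n : nat) (K : set 'rV[R]_n) x (l : R) :
  convex_body_o K -> 0 < l -> gauge K x <= l <-> dilate l K x.
Proof.
move=> hK l0; split=> [xl|]; last by apply: gauge_le; exact: ltW.
have cK : closed K by apply: compact_closed; [exact: norm_hausdorff|case: hK].
suff Kx : K (l^-1 *: x).
  by exists (l^-1 *: x) => //; rewrite scalerA mulfV ?gt_eqF// scale1r.
apply: contrapT => nKx.
have cf : (fun m : R => m^-1 *: x) @ l --> l^-1 *: x.
  by apply: cvgZr_tmp; apply: cvgV; [rewrite gt_eqF|exact: cvg_id].
have /cvg_at_right_filter cfr := cf.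
have oK : nbhs (l^-1 *: x) (~` K).
  by apply: open_nbhs_nbhs; split => //; exact: closed_openC.
have h := cfr _ oK.
near l^'+ => m.
have lm : l < m by near: m; exact: nbhs_right_gt.
have : (~` K) (m^-1 *: x) by near: m.
apply; have [k Kk <-] : dilate m K x by apply: gauge_lt => //; exact: le_lt_trans lm.
by rewrite scalerA mulVf ?scale1r// gt_eqF// (lt_trans l0).
Unshelve. all: by end_near. Qed.

Lemma gaugeD (R : realType) (n : nat) (K : set 'rV[R]_n) x y :
  convex_body_o K -> gauge K (x + y) <= gauge K x + gauge K y.
Proof.
move=> hK; apply/ler_addgt0Pr => e e0.
have e20 : 0 < e / 2 by rewrite divr_gt0.
rewrite (_ : gauge K x + gauge K y + e =
  (gauge K x + e / 2) + (gauge K y + e / 2)); last by rewrite addrACA -splitr.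
have := @gauge_lt _ _ K x (gauge K x + e / 2) hK ltac:(by rewrite ltrDl).
have := @gauge_lt _ _ K y (gauge K y + e / 2) hK ltac:(by rewrite ltrDl).
have := gauge_ge0 x hK; have := gauge_ge0 y hK.
move: (gauge K x) (gauge K y) => a b b0 a0.
have : 0 < b + e / 2 by rewrite ltr_wpDl.
have : 0 < a + e / 2 by rewrite ltr_wpDl.
move: (a + _) (b + _) => {a0} u {b0} v u0 v0 [k Kk <-] [l Kl <-].
have uv0 : 0 < u + v by rewrite addr_gt0.
apply: gauge_le; first exact: ltW.
exists ((u / (u + v)) *: l + (1 - u / (u + v)) *: k).
  apply: convex_body_conv => //.
  by rewrite divr_ge0 ?(ltW u0) ?(ltW uv0)//= ler_pdivrMr// mul1r lerDl ltW.
rewrite scalerDr !scalerA mulrBr mulr1 mulrC divfK ?gt_eqF//.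
by rewrite [u + v]addrC addrK.
Qed.

Lemma gaugeN (R : realType) (n : nat) (K : set 'rV[R]_n) x :
  o_symmetric K -> gauge K (- x) = gauge K x.
Proof.
move=> sK.
have KN k : K k -> K (- k) by move=> Kk; rewrite [K]sK; exists k.
congr inf; apply/seteqP; split=> l [l0 [k Kk kx]]; split=> //; exists (- k).
- exact: KN.
- by rewrite scalerN kx opprK.
- exact: KN.
- by rewrite scalerN kx.
Qed.

Lemma gauge_norm (R : realType) (n : nat) (K : set 'rV[R]_n) :
  convex_body_o K -> exists2 C, 0 < C & forall x, gauge K x <= C * `|x|.
Proof.
move=> hK; have [C C0 CK] := convex_body_absorbing hK; exists C => // x.
apply/ler_addgt0Pr => e e0; apply: gauge_le.
  by rewrite addr_ge0// ?mulr_ge0// ltW.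
by apply: CK; rewrite ltrDl.
Qed.

Lemma convex_body_norm (R : realType) (n : nat) (K : set 'rV[R]_n) :
  convex_body_o K -> exists2 M, 0 < M & forall x, K x -> `|x| <= M.
Proof.
move=> [/compact_bounded[M [_ MK]] _ _].
exists (`|M| + 1) => [|x Kx]; first by rewrite ltr_wpDl.
by apply: MK => //; rewrite (le_lt_trans (ler_norm _))// ltrDl.
Qed.

Lemma null_measurable (R : realType) (n : nat) (A : set 'rV[R]_n) :
  lebesgue_outer A = 0%E -> measurable (A : set (Rn R n)).
Proof.
move=> A0; apply: le_caratheodory_measurable => X.
rewrite [X in (X + _)%E](_ : _ = 0%E) ?add0e; last first.
  by apply: lebesgue_outer_null_subset A0 => x [].
by apply: le_lebesgue_outer => x [].
Qed.

(** By completeness, [negligible] and [\ae] become statements about outer measure 0, which can be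
    handled without measurability side conditions. *)
Lemma negligible_lebesgueP (R : realType) (n : nat) (A : set 'rV[R]_n) :
  (@lebesgue R n).-negligible A <-> lebesgue_outer A = 0%E.
Proof.
split=> [[B [_ B0 AB]]|A0]; first exact: lebesgue_outer_null_subset B0.
by exists A; split => //; exact: null_measurable.
Qed.

Lemma ae_lebesgueP (R : realType) (n : nat) (P : 'rV[R]_n -> Prop) :
  (\forall x \ae @lebesgue R n, P x) <-> lebesgue_outer [set x | ~ P x] = 0%E.
Proof. exact: negligible_lebesgueP. Qed.

(** The strict inequality makes this set open for every [E]; it replaces
    [minkowski_sum E (dilate d K)] wherever measurability or some slack in the distance is
    wanted. *)
Definition gauge_nbhd (R : realType) (n : nat) (K : set 'rV[R]_n) (d : R)
    (E : set 'rV[R]_n) : set 'rV[R]_n :=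
  [set y | exists2 x, E x & gauge K (y - x) < d].

Lemma gauge_nbhd_open (R : realType) (n : nat) (K : set 'rV[R]_n) (d : R)
    (E : set 'rV[R]_n) : convex_body_o K -> open (gauge_nbhd K d E).
Proof.
move=> hK; have [C C0 CK] := gauge_norm hK.
rewrite openE => y [x Ex yx]; apply/nbhs_ballP.
have r0 : 0 < (d - gauge K (y - x)) / C by rewrite divr_gt0// subr_gt0.
exists ((d - gauge K (y - x)) / C) => //= z yz; exists x => //.
rewrite -(subrK y z) -addrA (le_lt_trans (gaugeD _ _ hK))// -ltrBrDr.
rewrite (le_lt_trans (CK _))// mulrC -ltr_pdivlMr//.
by move: yz; rewrite -ball_normE/= distrC.
Qed.

Lemma gauge_nbhd_sub (R : realType) (n : nat) (K : set 'rV[R]_n) (d : R)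
    (E : set 'rV[R]_n) : convex_body_o K ->
  gauge_nbhd K d E `<=` minkowski_sum E (dilate d K).
Proof.
move=> hK y [x Ex yx]; exists x => //; exists (y - x); first exact: gauge_lt.
by rewrite addrC subrK.
Qed.

(* At a point x + d k of the boundary, the neighbourhood contains balls centred
   on the segment towards x, of radius proportional to the distance; hence its
   complement has no boundary point of density 1. *)
Lemma minkowski_boundary_null (R : realType) (n : nat) (K : set 'rV[R]_n) (d : R)
    (E : set 'rV[R]_n) : convex_body_o K -> 0 < d ->
  lebesgue_outer (minkowski_sum E (dilate d K) `\` gauge_nbhd K d E) = 0%E.
Proof.
move=> hK d0; have [C C0 CK] := gauge_norm hK; have [M M0 MK] := convex_body_norm hK.
(* With t = r/a, the ball of radius t d / C about the point z at parameter 1 - t of the segment lies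
   in the neighbourhood, and it lies in the ball of radius r about [y] since t d M + t d / C = r.
   Its radius is [b] times r. *)
pose a := d * (M + C^-1); have a0 : 0 < a by rewrite mulr_gt0// addr_gt0// invr_gt0.
pose b := d / C / a; have b0 : 0 < b by rewrite !divr_gt0.
have c0 : 0 < b ^+ n by rewrite exprn_gt0.
apply: (@density_null _ _ (~` gauge_nbhd K d E) _ _ _ _ c0).
- by apply: measurableC; apply: open_measurable_rV; exact: gauge_nbhd_open.
- by move=> x [].
move=> y [[x Ex [_ [k Kk <-] xy]] _] e e0.
pose r := Num.min e a / 2; have m0 : 0 < Num.min e a by rewrite lt_min e0.
have r0 : 0 < r by rewrite divr_gt0.
have rm : r < Num.min e a by rewrite /r ltr_pdivrMr// ltr_pMr// ltr1n.
move: (rm); rewrite lt_min => /andP[re ra].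
exists r; first by rewrite r0.
pose t := r / a.
have t0 : 0 < t by rewrite divr_gt0.
have t1 : t < 1 by rewrite ltr_pdivrMr// mul1r.
pose z := x + ((1 - t) * d) *: k.
have -> : b ^+ n * r ^+ n = (t * d / C) ^+ n.
  rewrite -exprMn /b /t; congr (_ ^+ _).
  by field; rewrite !gt_eqF.
have s0 : 0 < t * d / C by rewrite divr_gt0// mulr_gt0.
apply: (le_trans (lebesgue_outer_ball_ge z s0)); apply: le_lebesgue_outer => w.
rewrite -!ball_normE/= => zw; split; last first.
  apply; exists x => //.
  rewrite -(subrK z w) -addrA (le_lt_trans (gaugeD _ _ hK))//.
  have gz : gauge K (z - x) <= (1 - t) * d.
    rewrite /z addrC addKr; apply: gauge_le; last by exists k.
    by rewrite mulr_ge0 ?subr_ge0// ltW.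
  rewrite (le_lt_trans (lerD (CK _) gz))//.
  move: zw; rewrite distrC ltr_pdivlMr// mulrC mulrBl mul1r; lra.
rewrite -xy -(subrK z (x + _)) -addrA (le_lt_trans (ler_normD _ _))//.
have -> : x + d *: k - z = (t * d) *: k.
  by rewrite /z opprD addrACA subrr add0r -scalerBl mulrBl mul1r opprB addrC subrK.
rewrite normrZ (gtr0_norm (mulr_gt0 t0 d0)).
have := MK _ Kk; rewrite -(ler_pM2l (mulr_gt0 t0 d0)) => kM.
have -> : r = t * d * M + t * d / C.
  by rewrite -mulrDr -mulrA -/a /t divfK// gt_eqF.
by rewrite ler_ltD.
Qed.

(** An open set together with a null part of the boundary, whatever [E] is. *)
Lemma minkowski_measurable (R : realType) (n : nat) (K : set 'rV[R]_n) (d : R)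
    (E : set 'rV[R]_n) : convex_body_o K -> 0 < d ->
  measurable (minkowski_sum E (dilate d K) : set (Rn R n)).
Proof.
move=> hK d0.
have -> : minkowski_sum E (dilate d K) = gauge_nbhd K d E `|`
    (minkowski_sum E (dilate d K) `\` gauge_nbhd K d E).
  by rewrite setDUK//; exact: gauge_nbhd_sub.
apply: measurableU; first by apply: open_measurable_rV; exact: gauge_nbhd_open.
by apply: null_measurable; exact: minkowski_boundary_null.
Qed.

(** The product of the piece of [P] near [x0] with the piece of [Q] near [y0] consists of close
    pairs, and a product of non-null sets is non-null. *)
Lemma close_pairs_not_null (R : realType) (n : nat) (K : set 'rV[R]_n) (d : R)
    (P Q : set 'rV[R]_n) x0 y0 : convex_body_o K -> gauge K (x0 - y0) < d ->
  (forall r, 0 < r -> lebesgue_outer (P `&` ball x0 r) != 0%E) ->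
  (forall r, 0 < r -> lebesgue_outer (Q `&` ball y0 r) != 0%E) ->
  lebesgue_outer [set z : 'rV[R]_(n + n) | [/\ P (lsubmx z), Q (rsubmx z) &
    gauge K (lsubmx z - rsubmx z) <= d]] != 0%E.
Proof.
move=> hK xyd Px Qy; have [C C0 CK] := gauge_norm hK.
(* Moving both points by at most [r] changes the gauge of their difference by at most 2 C r, which
   is the slack left below [d]. *)
pose r := (d - gauge K (x0 - y0)) / C / 2.
have r0 : 0 < r by rewrite !divr_gt0// subr_gt0.
apply: contraNneq (lebesgue_outer_rows_prod_null (Px r r0) (Qy r r0)) => PQ0.
apply/eqP; apply: lebesgue_outer_null_subset PQ0 => z [[Pz xz] [Qz yz]]; split => //.
rewrite -(subrK (x0 - y0) (lsubmx z - _)) (le_trans (gaugeD _ _ hK))// -lerBrDr.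
rewrite (le_trans (CK _))// mulrC -ler_pdivlMr//.
have -> : lsubmx z - rsubmx z - (x0 - y0) = (y0 - rsubmx z) - (x0 - lsubmx z).
  by apply/rowP => i; rewrite !mxE; ring.
move: xz yz; rewrite -!ball_normE/= => xz yz.
by rewrite (le_trans (ler_normB _ _))// (splitr (_ / C)) lerD// ltW.
Qed.

(** * Rearrangements and superlevel sets *)

Definition ess_eq (R : realType) (n : nat) (A B : set 'rV[R]_n) : Prop :=
  lebesgue_outer (A `\` B) = 0%E /\ lebesgue_outer (B `\` A) = 0%E.

Lemma ess_eq_sym (R : realType) (n : nat) (A B : set 'rV[R]_n) :
  ess_eq A B -> ess_eq B A.
Proof. by case. Qed.

Lemma ess_sub_trans (R : realType) (n : nat) (A B C : set 'rV[R]_n) :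
  lebesgue_outer (A `\` B) = 0%E -> lebesgue_outer (B `\` C) = 0%E ->
  lebesgue_outer (A `\` C) = 0%E.
Proof.
move=> AB BC; apply: lebesgue_outer_null_subset (lebesgue_outer_null_setU AB BC).
by move=> x [Ax nCx]; have [Bx|nBx] := pselect (B x); [right|left].
Qed.

Lemma ess_eq_trans (R : realType) (n : nat) (A B C : set 'rV[R]_n) :
  ess_eq A B -> ess_eq B C -> ess_eq A C.
Proof. by move=> [? ?] [? ?]; split;
  [apply: (@ess_sub_trans _ _ _ B)|apply: (@ess_sub_trans _ _ _ B)]. Qed.

(** Monotonicity of [T] yields only essential inclusions; equimeasurability supplies equal finite
    measures, and this lemma turns the two into essential equality. *)
Lemma ess_sub_eq (R : realType) (n : nat) (A B : set 'rV[R]_n) :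
  measurable (A : set (Rn R n)) -> measurable (B : set (Rn R n)) ->
  lebesgue_outer A = lebesgue_outer B -> (lebesgue_outer A < +oo)%E ->
  lebesgue_outer (A `\` B) = 0%E -> ess_eq A B.
Proof.
move=> mA mB AB Afin AB0; split => //.
have hA : (lebesgue_outer A = lebesgue_outer (A `&` B) + lebesgue_outer (A `\` B))%E.
  exact: mB.
have hB : (lebesgue_outer B = lebesgue_outer (A `&` B) + lebesgue_outer (B `\` A))%E.
  by rewrite setIC; exact: mA.
move: hB; rewrite -AB hA AB0 adde0.
have Ifin : lebesgue_outer (A `&` B) \is a fin_num.
  by rewrite ge0_fin_numE ?lebesgue_outer_ge0//; apply: le_lt_trans Afin;
    apply: le_lebesgue_outer => x [].
by rewrite -[X in X = _ -> _]adde0 => /(congr1 (fun u => u - lebesgue_outer (A `&` B))%E);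
  rewrite [(_ + 0)%E]addeC [X in _ = (X - _)%E]addeC !addeK.
Qed.

(** * Superlevel sets and the two function spaces *)

Definition superlevel (R : realType) (n : nat) (f : 'rV[R]_n -> R) (t : R) :
  set 'rV[R]_n := [set x | t < f x].

Lemma measurable_superlevel (R : realType) (n : nat) (f : 'rV[R]_n -> R) :
  measurable_fun [set: Rn R n] (f : Rn R n -> R) <->
  forall t, measurable (superlevel f t : set (Rn R n)).
Proof.
split=> [mf t|mf].
  have -> : (superlevel f t : set (Rn R n)) = setT `&` (f : Rn R n -> R) @^-1` `]t,
    +oo[%classic.
    by rewrite setTI; apply/seteqP; split => x /=; rewrite in_itv/= andbT.
  by apply: mf => //; exact: measurable_itv.
move=> mT; apply: (measurability _ (RGenOInfty.measurableE R)) => //.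
move=> /= _ [_ [t ->] <-]; rewrite setTI.
rewrite (_ : _ @^-1` _ = superlevel f t)//.
by apply/seteqP; split => x /=; rewrite in_itv/= andbT.
Qed.

(** A level does not exceed the essential infimum exactly when it is an essential lower bound, which
    removes [ess_inf] from the definition. *)
Lemma space_SP (R : realType) (n : nat) (f : 'rV[R]_n -> R) : space_S f <->
  (forall t, measurable (superlevel f t : set (Rn R n))) /\
  (forall t, (lebesgue_outer (superlevel f t) < +oo)%E \/
    lebesgue_outer [set x | ~ t <= f x] = 0%E).
Proof.
split=> [[mf ft]|[mf ft]]; split.
- exact: (measurable_superlevel f).1.
- move=> t; have [tf|/ft] := leP t%:E (ess_inf (@lebesgue R n) (EFin \o f)); last by left.
  by right; move/ess_infP : tf => /ae_lebesgueP.
- exact: (measurable_superlevel f).2.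
move=> t; have [//|t0] := ft t; rewrite ltNge => /negP; case.
by apply/ess_infP; apply/ae_lebesgueP; rewrite -t0; congr lebesgue_outer.
Qed.

(* The real numbers that may be the value of a function of X outside a set of
   finite measure. *)
Definition lower_value (R : realType) (n : nat) (X : set ('rV[R]_n -> R)) (a : R) :=
  X = @space_S R n \/ X = @space_V R n /\ a = 0.

(** The levels whose superlevel sets are compared under [T]; in [space_V] a negative level has the
    whole space as superlevel set. *)
Definition level_value (R : realType) (n : nat) (X : set ('rV[R]_n -> R)) (t : R) :=
  X = @space_S R n \/ X = @space_V R n /\ 0 <= t.

Lemma space_measurable (R : realType) (n : nat) (X : set ('rV[R]_n -> R)) f :
  X = @space_S R n \/ X = @space_V R n -> X f ->
  forall t, measurable (superlevel f t : set (Rn R n)).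
Proof. by case=> -> => [/space_SP[]//|[mf _ _]]; exact: (measurable_superlevel f).1. Qed.

Lemma space_levels (R : realType) (n : nat) (X : set ('rV[R]_n -> R)) f t :
  X = @space_S R n \/ X = @space_V R n -> X f ->
  (lebesgue_outer (superlevel f t) < +oo)%E /\ level_value X t \/
  lebesgue_outer [set x | ~ t <= f x] = 0%E.
Proof.
case=> XE; rewrite XE => Xf.
  by move/space_SP : Xf => [_ /(_ t)[]]; [left; split => //; left|right].
case: Xf => _ f0 ft; have [t0|t0] := ltP 0 t.
  by left; split; [exact: ft|right; split => //; exact: ltW].
by right; rewrite (_ : [set _ | _] = set0) ?lebesgue_outer0// -subset0 => x /=;
  rewrite (le_trans t0 (f0 x)).
Qed.

Lemma space_introS (R : realType) (n : nat) (f : 'rV[R]_n -> R) (A : set 'rV[R]_n) a :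
  (lebesgue_outer A < +oo)%E -> (forall x, a <= f x) ->
  (forall t, a <= t -> superlevel f t `<=` A) ->
  (forall t, a <= t -> measurable (superlevel f t : set (Rn R n))) ->
  space_S f.
Proof.
move=> Afin fa fA mf; apply/space_SP; split=> t; have [at_|ta] := leP a t.
- exact: mf.
- rewrite (_ : superlevel _ _ = setT)//; apply/seteqP; split => // x _ /=.
  exact: lt_le_trans (fa x).
- by left; apply: le_lt_trans Afin; apply: le_lebesgue_outer; exact: fA.
- right; rewrite (_ : [set _ | _] = set0) ?lebesgue_outer0// -subset0 => x /=.
  by rewrite (le_trans (ltW ta) (fa x)).
Qed.

Lemma space_intro (R : realType) (n : nat) (X : set ('rV[R]_n -> R)) f (A : set 'rV[R]_n) a :
  lower_value X a -> (lebesgue_outer A < +oo)%E -> (forall x, a <= f x) ->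
  (forall t, a <= t -> superlevel f t `<=` A) ->
  (forall t, a <= t -> measurable (superlevel f t : set (Rn R n))) ->
  X f.
Proof.
move=> Xa Afin fa fA mf; have [mf' ff] := space_introS Afin fa fA mf.
case: Xa => [->//|[-> a0]]; split => //; first by move=> x; rewrite -a0.
move=> t t0; apply: le_lt_trans Afin; apply: le_lebesgue_outer.
by apply: fA; rewrite a0 ltW.
Qed.

Definition step_fun (R : realType) (n : nat) (a b : R) (A : set 'rV[R]_n) (x : 'rV[R]_n) :=
  if x \in A then b else a.

Lemma superlevel_step (R : realType) (n : nat) (a b t : R) (A : set 'rV[R]_n) :
  a <= t < b -> superlevel (step_fun a b A) t = A.
Proof.
move=> /andP[a_t tb]; apply/seteqP; split => x; rewrite /superlevel /step_fun /=.
  by case: ifPn => [|_]; rewrite ?inE// ltNge a_t.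
by move=> /mem_set ->.
Qed.

Lemma space_step (R : realType) (n : nat) (X : set ('rV[R]_n -> R)) (A : set 'rV[R]_n) a b :
  lower_value X a -> a <= b -> (lebesgue_outer A < +oo)%E ->
  measurable (A : set (Rn R n)) -> X (step_fun a b A).
Proof.
move=> Xa ab Afin mA; apply: (space_intro Xa Afin) => [x|t a_t|t a_t].
- by rewrite /step_fun; case: ifP.
- move=> x; rewrite /superlevel /step_fun/=; case: ifPn => [|_]; first by rewrite inE.
  by rewrite ltNge a_t.
- have [tb|bt] := ltP t b; first by rewrite superlevel_step// a_t.
  rewrite (_ : superlevel _ _ = set0)// -subset0 => x; rewrite /superlevel /step_fun/=.
  by case: ifP => _; rewrite ltNge ?bt ?a_t.
Qed.

Lemma indic_step (R : realType) (n : nat) (A : set 'rV[R]_n) :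
  \1_A = step_fun 0 1 A :> ('rV[R]_n -> R).
Proof. by apply/funext => x; rewrite indicE /step_fun; case: (x \in A). Qed.

(** Since T f <= T g essentially and q <= p, the first set is essentially contained in the second;
    both have the finite measure of the common superlevel set of f and g. *)
Lemma rearrangement_superlevel_le (R : realType) (n : nat) (X : set ('rV[R]_n -> R)) T f g p q :
  X = @space_S R n \/ X = @space_V R n -> rearrangement X T ->
  X f -> X g -> (forall x, f x <= g x) -> q <= p ->
  superlevel f p = superlevel g q -> (lebesgue_outer (superlevel f p) < +oo)%E ->
  ess_eq (superlevel (T f) p) (superlevel (T g) q).
Proof.
move=> hX [TX Teq Tmono] Xf Xg fg qp lfg ffin.
have ef : lebesgue_outer (superlevel (T f) p) = lebesgue_outer (superlevel f p).
  exact: Teq.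
have eg : lebesgue_outer (superlevel (T g) q) = lebesgue_outer (superlevel g q).
  exact: Teq.
apply: ess_sub_eq.
- by apply: (space_measurable hX); exact: TX.
- by apply: (space_measurable hX); exact: TX.
- by rewrite ef eg lfg.
- by rewrite ef.
have /ae_lebesgueP := Tmono f g Xf Xg ltac:(exact: aeW).
apply: lebesgue_outer_null_subset => x [/= pf /negP]; rewrite -leNgt => gq /(lt_le_trans pf).
by rewrite ltNge (le_trans gq qp).
Qed.

Lemma rearrangement_step_level (R : realType) (n : nat) (X : set ('rV[R]_n -> R)) T
    (A : set 'rV[R]_n) a b p q :
  X = @space_S R n \/ X = @space_V R n -> rearrangement X T -> lower_value X a ->
  measurable (A : set (Rn R n)) -> (lebesgue_outer A < +oo)%E ->
  a <= p < b -> a <= q < b ->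
  ess_eq (superlevel (T (step_fun a b A)) p) (superlevel (T (step_fun a b A)) q).
Proof.
move=> hX hT Xa mA Afin pab qab.
have ab : a <= b by case/andP : pab => ? /ltW; exact: le_trans.
have Xs := space_step Xa ab Afin mA.
wlog qp : p q pab qab / q <= p.
  move=> h; have [|/ltW] := leP q p; first exact: h.
  by move=> pq; apply: ess_eq_sym; exact: h.
by apply: (rearrangement_superlevel_le hX hT) => //; rewrite !superlevel_step.
Qed.

(** By the hypothesis a' < b, both step functions have superlevel set [A] at the level a'; they are
    compared there, after moving [p] and [q] to that level. *)
Lemma rearrangement_step_le (R : realType) (n : nat) (X : set ('rV[R]_n -> R)) T
    (A : set 'rV[R]_n) a b a' b' p q :
  X = @space_S R n \/ X = @space_V R n -> rearrangement X T ->
  lower_value X a -> lower_value X a' ->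
  measurable (A : set (Rn R n)) -> (lebesgue_outer A < +oo)%E ->
  a <= a' -> b <= b' -> a' < b -> a <= p < b -> a' <= q < b' ->
  ess_eq (superlevel (T (step_fun a b A)) p) (superlevel (T (step_fun a' b' A)) q).
Proof.
move=> hX hT Xa Xa' mA Afin aa' bb' a'b pab qab.
have h1 : a <= a' < b by rewrite aa'.
have h2 : a' <= a' < b' by rewrite lexx/= (lt_le_trans a'b).
apply: ess_eq_trans (rearrangement_step_level hX hT Xa mA Afin pab h1) _.
apply: ess_eq_trans _ (rearrangement_step_level hX hT Xa' mA Afin h2 qab).
apply: (rearrangement_superlevel_le hX hT) => //.
- by apply: space_step => //; rewrite (le_trans aa')// ltW.
- by apply: space_step => //; rewrite (le_trans (ltW a'b)).
- by move=> x; rewrite /step_fun; case: ifP.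
- by rewrite !superlevel_step.
- by rewrite superlevel_step.
Qed.

(** All levels in [0, 1) give the same superlevel set of [T \1_A] up to null sets, and the one at
    level 1 is null by equimeasurability. So where [T \1_A] is positive it is essentially 1. *)
Lemma rearrangement_indic (R : realType) (n : nat) (X : set ('rV[R]_n -> R)) T
    (A : set 'rV[R]_n) :
  X = @space_S R n \/ X = @space_V R n -> rearrangement X T ->
  measurable (A : set (Rn R n)) -> (lebesgue_outer A < +oo)%E ->
  ess_eq (superlevel (T \1_A) 0) (diamond T A).
Proof.
move=> hX hT mA Afin.
have X0 : lower_value X 0 by case: hX => [?|?]; [left|right].
have X1 : X \1_A by rewrite indic_step; apply: space_step.
split; last first.
  rewrite (_ : _ `\` _ = set0) ?lebesgue_outer0// -subset0 => x [Tx]; case.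
  by rewrite /superlevel/= (_ : T \1_A x = 1).
have T1 : lebesgue_outer (superlevel (T \1_A) 1) = 0%E.
  have [_ Teq _] := hT;
    rewrite [LHS](Teq _ X1 1) -/(superlevel \1_A 1) (_ : superlevel _ _ = set0)
      ?lebesgue_outer0//.
  by rewrite -subset0 => x; rewrite /superlevel/= indicE; case: (_ \in _); rewrite ?ltxx ?ltr10.
have Tk k : lebesgue_outer (superlevel (T \1_A) 0 `\` superlevel (T \1_A) (1 - k.+1%:R^-1)) =
  0%E.
  rewrite indic_step.
  have [||//] := @rearrangement_step_level _ _ X T A 0 1 0 (1 - k.+1%:R^-1) hX hT X0 mA Afin.
    by rewrite lexx/=.
  by rewrite subr_ge0 invf_le1//= ler1n/= ltrBlDr ltrDl.
apply: lebesgue_outer_null_subset (lebesgue_outer_null_setU T1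
  (lebesgue_outer_null_bigcup Tk)).
move=> x [T0 /eqP]; rewrite neq_lt => /orP[Tlt|]; last by left.
right; have : 0 < 1 - T \1_A x by rewrite subr_gt0.
move=> e0; have [k ke] : exists k, k.+1%:R^-1 < 1 - T \1_A x.
  near \oo => k; exists k; near: k.
  exact: (near_infty_natSinv_lt (PosNum e0)).
exists k => //; split => //; apply/negP; rewrite -leNgt.
by move: ke; move: (_^-1) => u; lra.
Unshelve. all: by end_near. Qed.

(* Monotonicity only compares T on comparable functions: f is linked to the
   indicator function of its superlevel set by a zigzag of functions having
   that same superlevel set. *)
Lemma rearrangement_superlevel (R : realType) (n : nat) (X : set ('rV[R]_n -> R)) T f p :
  X = @space_S R n \/ X = @space_V R n -> rearrangement X T -> X f ->
  (lebesgue_outer (superlevel f p) < +oo)%E -> level_value X p ->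
  ess_eq (superlevel (T f) p) (diamond T (superlevel f p)).
Proof.
move=> hX hT Xf Afin Xp; set A := superlevel f p.
have mA : measurable (A : set (Rn R n)) by exact: space_measurable hX Xf p.
apply: ess_eq_trans (rearrangement_indic hX hT mA Afin); rewrite indic_step.
have X0 : lower_value X 0 by case: hX => [?|?]; [left|right].
(* [h a] is the link between [f] and step functions: it is bounded by p + 1 and constant off [A], so
   it lies below [step_fun a (p + 1) A], and it has superlevel set [A] at level [p]. *)
pose h a x := if x \in A then Num.min (f x) (p + 1) else a.
have hE a : a <= p -> superlevel (h a) p = A.
  move=> ap; apply/seteqP; split => x; rewrite /superlevel /h /=.
    by case: ifPn => [|_]; rewrite ?inE// ltNge ap.
  by move=> Ax; rewrite mem_set// lt_min Ax/= ltrDl.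
have Xh a : a <= p -> lower_value X a -> X (h a).
  move=> ap Xa; apply: (space_intro Xa Afin) => [x|t a_t|t a_t].
  - rewrite /h; case: ifPn => //; rewrite inE => Ax.
    by rewrite le_min (le_trans ap (ltW Ax))/= (le_trans ap)// lerDl.
  - move=> x; rewrite /superlevel/h/=; case: ifPn => [|_]; first by rewrite inE.
    by rewrite ltNge a_t.
  - have [tp|pt] := leP (p + 1) t.
      rewrite (_ : superlevel _ _ = set0)// -subset0 => x; rewrite /superlevel /h /=.
      by case: ifP => _; rewrite ?lt_min ltNge ?a_t// (ltNge t) tp andbF.
    rewrite (_ : superlevel _ _ = A `&` superlevel f t).
      by apply: measurableI => //; exact: space_measurable hX Xf t.
    apply/seteqP; split => x; rewrite /superlevel /h /=.
      by case: ifPn => [|_]; [rewrite inE lt_min => Ax /andP[? _]; split|rewrite ltNge a_t].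
    by move=> [Ax tx]; rewrite mem_set// lt_min tx.
have h_step a : a <= p -> lower_value X a -> ess_eq (superlevel (T (h a)) p)
    (superlevel (T (step_fun a (p + 1) A)) p).
  move=> ap Xa; have p1 : a <= p < p + 1 by rewrite ap ltrDl ltr01.
  apply: (rearrangement_superlevel_le hX hT) => //.
  - exact: Xh.
  - by apply: space_step => //; rewrite (le_trans ap)// lerDl.
  - by move=> x; rewrite /h /step_fun; case: ifP => // _; rewrite ge_min lexx orbT.
  - by rewrite hE// superlevel_step.
  - by rewrite hE.
case: Xp => [XS|[XV p0]].
- have lv a : lower_value X a by left.
  pose g x := Num.max (f x) p.
  have gE t : p <= t -> superlevel g t = superlevel f t.
    by move=> pt; apply/seteqP; split => x;
      rewrite /superlevel /g /= lt_max (ltNge t p) pt orbF.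
  have Xg : X g.
    apply: (space_intro (lv p) Afin) => [x|t pt|t pt].
    - by rewrite /g le_max lexx orbT.
    - by rewrite gE// => x; exact: le_lt_trans.
    - by rewrite gE//; exact: space_measurable hX Xf t.
  apply: (@ess_eq_trans _ _ _ (superlevel (T g) p)).
    apply: (rearrangement_superlevel_le hX hT) => //; last by rewrite gE.
    by move=> x; rewrite /g le_max lexx.
  apply: (@ess_eq_trans _ _ _ (superlevel (T (h p)) p)).
    apply: ess_eq_sym; apply: (rearrangement_superlevel_le hX hT) => //.
    + exact: Xh.
    + by move=> x; rewrite /g /h; case: ifP => _; rewrite le_max ?ge_min lexx ?orbT.
    + by rewrite hE// gE.
    + by rewrite hE.
  apply: ess_eq_trans (h_step p (lexx _) (lv p)) _.
  (* This height is at least both 1 and p + 1 and exceeds both 0 and p, so the base can be moved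
     from [p] to 0, for either sign of [p], before the height is lowered to 1. *)
  pose b := `|p| + 1.
  have pb : p < b by rewrite (le_lt_trans (ler_norm p))// ltrDl.
  have b1 : 1 <= b by rewrite lerDr.
  have pb1 : p + 1 <= b by rewrite lerD2r ler_norm.
  apply: (@ess_eq_trans _ _ _ (superlevel (T (step_fun p b A)) p)).
    by apply: (rearrangement_step_le hX hT) => //; rewrite ?lexx ?ltrDl ?ltr01.
  apply: (@ess_eq_trans _ _ _ (superlevel (T (step_fun 0 b A)) 0)); last first.
    apply: ess_eq_sym; apply: (rearrangement_step_le hX hT) => //; rewrite ?lexx ?ltr01//=.
    exact: lt_le_trans b1.
  have [p0|/ltW p0] := leP p 0.
    apply: (rearrangement_step_le hX hT) => //; rewrite ?lexx//=; exact: lt_le_trans b1.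
  apply: ess_eq_sym; apply: (rearrangement_step_le hX hT) => //; rewrite ?lexx//=.
  exact: lt_le_trans b1.
(* In [space_V] the base must be 0. Here [h 0] lies below [f] because [f] is nonnegative, so the
   detour through [g] is avoided. *)
- apply: (@ess_eq_trans _ _ _ (superlevel (T (h 0)) p)).
    apply: ess_eq_sym; apply: (rearrangement_superlevel_le hX hT) => //.
    + exact: Xh.
    + move=> x; rewrite /h; case: ifP => _; first by rewrite ge_min lexx.
      by move: Xf; rewrite XV => -[].
    + by rewrite hE.
    + by rewrite hE.
  apply: ess_eq_trans (h_step 0 p0 X0) _.
  apply: ess_eq_sym; apply: (rearrangement_step_le hX hT) => //; rewrite ?lexx ?ltr01//=.
  + by rewrite lerDr.
  + by rewrite p0 ltrDl ltr01.
Qed.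

Lemma ess_eq_measurable (R : realType) (n : nat) (A B : set 'rV[R]_n) :
  ess_eq A B -> measurable (A : set (Rn R n)) -> measurable (B : set (Rn R n)).
Proof.
move=> [AB BA] mA.
have -> : (B : set (Rn R n)) = (A `\` (A `\` B)) `|` (B `\` A).
  apply/seteqP; split => x; last by case=> -[] // Ax nAB; apply: contrapT => nB; apply: nAB.
  by move=> Bx; have [Ax|nAx] := pselect (A x); [left; split=> // -[]|right].
apply: measurableU; last exact: null_measurable.
by apply: measurableD => //; exact: null_measurable.
Qed.

Lemma ess_sub_le (R : realType) (n : nat) (A B : set 'rV[R]_n) :
  lebesgue_outer (A `\` B) = 0%E -> (lebesgue_outer A <= lebesgue_outer B)%E.
Proof.
move=> AB0; apply: (@le_trans _ _ (lebesgue_outer (B `|` (A `\` B)))).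
  by apply: le_lebesgue_outer => x Ax; have [?|?] := pselect (B x); [left|right].
by apply: (le_trans (outer_measureU2 _ _ _)); rewrite [X in (_ + X)%E]AB0 adde0.
Qed.

Lemma ess_eq_outer (R : realType) (n : nat) (A B : set 'rV[R]_n) :
  ess_eq A B -> lebesgue_outer A = lebesgue_outer B.
Proof. by move=> [AB BA]; apply/eqP; rewrite eq_le !ess_sub_le. Qed.

Lemma density_points_ess_eq (R : realType) (n : nat) (E : set 'rV[R]_n) :
  measurable (E : set (Rn R n)) -> ess_eq E (density_points E).
Proof. by move=> mE; split; [exact: sub_density_points|exact: density_points_sub]. Qed.

Lemma space_indic (R : realType) (n : nat) (X : set ('rV[R]_n -> R)) (A : set 'rV[R]_n) :
  X = @space_S R n \/ X = @space_V R n ->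
  measurable (A : set (Rn R n)) -> (lebesgue_outer A < +oo)%E -> X \1_A.
Proof.
move=> hX mA Afin; rewrite indic_step; apply: space_step => //.
by case: hX => [?|?]; [left|right].
Qed.

Lemma diamond_measurable (R : realType) (n : nat) (X : set ('rV[R]_n -> R)) T
    (A : set 'rV[R]_n) :
  X = @space_S R n \/ X = @space_V R n -> rearrangement X T ->
  measurable (A : set (Rn R n)) -> (lebesgue_outer A < +oo)%E ->
  measurable (diamond T A : set (Rn R n)).
Proof.
move=> hX hT mA Afin; apply: ess_eq_measurable (rearrangement_indic hX hT mA Afin) _.
by apply: (space_measurable hX); case: hT => TX _ _; apply: TX; exact: space_indic.
Qed.

Lemma diamond_outer (R : realType) (n : nat) (X : set ('rV[R]_n -> R)) T
    (A : set 'rV[R]_n) :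
  X = @space_S R n \/ X = @space_V R n -> rearrangement X T ->
  measurable (A : set (Rn R n)) -> (lebesgue_outer A < +oo)%E ->
  lebesgue_outer (diamond T A) = lebesgue_outer A.
Proof.
move=> hX hT mA Afin; rewrite -(ess_eq_outer (rearrangement_indic hX hT mA Afin)).
case: hT => _ Teq _; rewrite [LHS](Teq _ (space_indic hX mA Afin)) -/(superlevel \1_A 0).
by rewrite indic_step superlevel_step// lexx ltr01.
Qed.

Lemma diamond_mono (R : realType) (n : nat) (X : set ('rV[R]_n -> R)) T
    (A B : set 'rV[R]_n) :
  X = @space_S R n \/ X = @space_V R n -> rearrangement X T ->
  measurable (A : set (Rn R n)) -> measurable (B : set (Rn R n)) ->
  (lebesgue_outer B < +oo)%E -> lebesgue_outer (A `\` B) = 0%E ->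
  lebesgue_outer (diamond T A `\` diamond T B) = 0%E.
Proof.
move=> hX hT mA mB Bfin AB0.
have Afin : (lebesgue_outer A < +oo)%E by apply: le_lt_trans Bfin; exact: ess_sub_le.
apply: ess_sub_trans (rearrangement_indic hX hT mA Afin).2 _.
apply: ess_sub_trans _ (rearrangement_indic hX hT mB Bfin).1.
have [_ _ Tmono] := hT.
have /ae_lebesgueP : \forall x \ae @lebesgue R n, T \1_A x <= T \1_B x.
  apply: Tmono; [exact: space_indic|exact: space_indic|].
  apply/ae_lebesgueP; apply: lebesgue_outer_null_subset AB0 => x /= /negP.
  rewrite -ltNge !indicE; have [Ax|nAx] := boolP (x \in A); have [Bx|nBx] := boolP (x \in B);
    rewrite ?ltxx ?ltr01 ?ltr10// => _.
  by split; [rewrite inE in Ax|move=> /mem_set; apply/negP].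
apply: lebesgue_outer_null_subset => x [Ax nBx] /= le; apply: nBx.
exact: lt_le_trans le.
Qed.

(** * Smoothing and moduli of continuity *)

Lemma superlevel_minkowski_null (R : realType) (n : nat) (K : set 'rV[R]_n) f (d r t : R) :
  convex_body_o K -> o_symmetric K -> 0 < d ->
  (forall u, measurable (superlevel f u : set (Rn R n))) ->
  lebesgue_outer [set z : 'rV[R]_(n + n) | ~ (gauge K (lsubmx z - rsubmx z) <= d ->
    `|f (lsubmx z) - f (rsubmx z)| <= r)] = 0%E ->
  lebesgue_outer (minkowski_sum (superlevel f (t + r) `&` density_points (superlevel f (t + r)))
    (dilate d K) `\` superlevel f t) = 0%E.
Proof.
move=> hK sK d0 mf fz.
set E := _ `&` density_points _.
(* Discarding the null boundary leaves only pairs at distance strictly less than [d], as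
   [close_pairs_not_null] requires. *)
apply: (ess_sub_trans (minkowski_boundary_null E hK d0)).
have mC : measurable (~` superlevel f t : set (Rn R n)) by exact: measurableC.
apply: lebesgue_outer_null_subset (sub_density_points mC) => y [[x [Ex Edx] yx] nfy].
split => // Cy.
have xy : gauge K (x - y) < d by rewrite -opprB gaugeN.
have /eqP := @close_pairs_not_null _ _ K d (superlevel f (t + r)) (~` superlevel f t) x y hK xy
  (fun r => density_points_ball Edx) (fun r => density_points_ball Cy).
apply; apply: lebesgue_outer_null_subset fz => z [Pz Qz gz] /= /(_ gz).
move/negP: Qz; rewrite -leNgt; rewrite /superlevel /= in Pz.
by rewrite ler_norml => Qz /andP[_]; lra.
Qed.

(** Smoothing is applied to bounded pieces of a superlevel set. The exceptional set [N] collects the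
    points of {T f > t + r} outside all images of the pieces, and the null errors of the smoothing
    inclusions; off [N] the conclusion holds pointwise. *)
Lemma smoothing_level_pairs (R : realType) (n : nat) (X : set ('rV[R]_n -> R)) T
    (K : set 'rV[R]_n) f (d r t : R) :
  X = @space_S R n \/ X = @space_V R n -> rearrangement X T ->
  convex_body_o K -> o_symmetric K -> K_smoothing K T -> 0 < d -> 0 <= r -> X f ->
  lebesgue_outer [set z : 'rV[R]_(n + n) | ~ (gauge K (lsubmx z - rsubmx z) <= d ->
    `|f (lsubmx z) - f (rsubmx z)| <= r)] = 0%E ->
  (lebesgue_outer (superlevel f t) < +oo)%E -> level_value X t ->
  exists N : set 'rV[R]_n, lebesgue_outer N = 0%E /\
    forall x y, ~ N x -> ~ N y -> t + r < T f x -> gauge K (x - y) <= d -> t < T f y.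
Proof.
move=> hX hT hK sK smooth d0 r0 Xf fz tfin Xt.
have mf u : measurable (superlevel f u : set (Rn R n)) by exact: space_measurable hX Xf u.
set Et := superlevel f t in tfin *; set Es := superlevel f (t + r).
have Est : Es `<=` Et by move=> x; apply: le_lt_trans; rewrite lerDl.
have sfin : (lebesgue_outer Es < +oo)%E by apply: le_lt_trans tfin; exact: le_lebesgue_outer.
have Xs : level_value X (t + r) by case: Xt => [?|[? ?]]; [left|right; split => //;
  rewrite addr_ge0].
(* Stray points must be removed before adding d K, since even a null set of them can have a non-null
   sum with d K. *)
pose E := Es `&` density_points Es.
have EsE : ess_eq Es E.
  have [h1 h2] := density_points_ess_eq (mf (t + r)); split.
    by apply: lebesgue_outer_null_subset h1 => x [Ex nE]; split=> // Dx; apply: nE.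
  by rewrite (_ : _ `\` _ = set0) ?lebesgue_outer0// -subset0 => x [[]].
have mE : measurable (E : set (Rn R n)) by exact: (ess_eq_measurable EsE (mf _)).
pose A k := E `&` ball 0 k.+1%:R.
have mA k : measurable (A k : set (Rn R n)) by apply: measurableI => //; exact: ball_measurable.
have AEs k : lebesgue_outer (A k `\` Es) = 0%E.
  by rewrite (_ : _ `\` _ = set0) ?lebesgue_outer0// -subset0 => x [[[]]].
have Afin k : (lebesgue_outer (A k) < +oo)%E by apply: le_lt_trans sfin; exact: ess_sub_le.
have bA k : bounded_set (A k).
  exists k.+1%:R; split; first exact: num_real.
  move=> b kb x [_]; rewrite -ball_normE/= sub0r normrN => /ltW xk.
  exact: le_trans (ltW kb).
pose M k := minkowski_sum (A k) (dilate d K).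
have mM k : measurable (M k : set (Rn R n)) by exact: minkowski_measurable.
have MEt k : lebesgue_outer (M k `\` Et) = 0%E.
  apply: lebesgue_outer_null_subset (superlevel_minkowski_null t hK sK d0 mf fz).
  by move=> y [[x [Ex _] [k' Kk' <-]] nEt]; split => //; exists x => //; exists k'.
have Mfin k : (lebesgue_outer (M k) < +oo)%E by apply: le_lt_trans tfin; exact: ess_sub_le.
have N2 k : lebesgue_outer (minkowski_sum (diamond_star T (A k)) (dilate d K)
    `\` superlevel (T f) t) = 0%E.
  have := smooth d (A k) d0 (bA k) (mA k); move=> /negligible_lebesgueP h.
  apply: ess_sub_trans h _.
  apply: ess_sub_trans (density_points_ess_eq (diamond_measurable hX hT (mM k) (Mfin k))).2 _.
  apply: ess_sub_trans (diamond_mono hX hT (mM k) (mf t) tfin (MEt k)) _.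
  exact: (rearrangement_superlevel hX hT Xf tfin Xt).2.
have N1 : lebesgue_outer (superlevel (T f) (t + r) `\` \bigcup_k diamond_star T (A k)) = 0%E.
  apply: ess_sub_trans (rearrangement_superlevel hX hT Xf sfin Xs).1 _.
  pose D := \bigcup_k diamond T (A k).
  have mDk k := diamond_measurable hX hT (mA k) (Afin k).
  have mD : measurable (D : set (Rn R n)) by exact: bigcupT_measurable.
  have mDs := diamond_measurable hX hT (mf (t + r)) sfin.
  apply: (@ess_sub_trans _ _ _ D); last first.
    have h k := (density_points_ess_eq (mDk k)).1.
    apply: lebesgue_outer_null_subset (lebesgue_outer_null_bigcup h).
    by move=> x [[k _ Dx] nD]; exists k => //; split => // Dk; apply: nD; exists k.
  have DDs : lebesgue_outer (D `\` diamond T Es) = 0%E.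
    have h k := diamond_mono hX hT (mA k) (mf (t + r)) sfin (AEs k).
    apply: lebesgue_outer_null_subset (lebesgue_outer_null_bigcup h).
    by move=> x [[k _ Dx] nD]; exists k.
  (* The inclusion of [D] in [diamond T Es] is reversed by measure: the pieces increase to [E], so
     their measures tend to that of [Es], and [T] preserves the measure of each piece. *)
  have DsD : lebesgue_outer D = lebesgue_outer (diamond T Es).
    apply/eqP; rewrite eq_le (ess_sub_le DDs) /= (diamond_outer hX hT (mf _) sfin)
      (ess_eq_outer EsE).
    have EA : E = \bigcup_k A k.
      apply/seteqP; split => [x Ex|x [k _ []]//].
      exists (Num.truncn `|x|) => //; split => //.
      by rewrite -ball_normE/= sub0r normrN truncnS_gt.
    have hc : @lebesgue R n \o A @ \oo --> @lebesgue R n (\bigcup_k A k).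
      apply: nondecreasing_cvg_mu => //; first by rewrite -EA.
      move=> i j ij; apply/subsetPset => x [Ex xi]; split => //.
      by apply: le_ball xi; rewrite ler_nat.
    rewrite EA; apply: (cvge_le _ hc); apply: nearW => k /=.
    rewrite -[leLHS](diamond_outer hX hT (mA k) (Afin k)).
    by apply: le_lebesgue_outer => x Dx; exists k.
  by apply: (ess_sub_eq mD mDs DsD _ DDs).2; rewrite DsD (diamond_outer hX hT (mf _) sfin).
exists ((superlevel (T f) (t + r) `\` \bigcup_k diamond_star T (A k)) `|`
  \bigcup_k (minkowski_sum (diamond_star T (A k)) (dilate d K) `\` superlevel (T f) t)).
split; first by apply: lebesgue_outer_null_setU => //; exact: lebesgue_outer_null_bigcup.
move=> x y nNx nNy xs xy.
have [k _ Ax] : (\bigcup_k diamond_star T (A k)) x.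
  by apply: contrapT => h; apply: nNx; left.
apply: contrapT => yt; apply: nNy; right; exists k => //; split => //.
exists x => //; exists (y - x); last by rewrite addrC subrK.
by apply/gauge_leP => //; rewrite -opprB gaugeN.
Qed.

(** If T f x - T f y > r, some rational lies strictly between T f y and T f x - r, so countably many
    levels and one null set [NN] suffice. A bad pair has a coordinate in [NN], and such pairs form a
    null set in the product. *)
Lemma smoothing_pairs (R : realType) (n : nat) (X : set ('rV[R]_n -> R)) T
    (K : set 'rV[R]_n) f (d r : R) :
  X = @space_S R n \/ X = @space_V R n -> rearrangement X T ->
  convex_body_o K -> o_symmetric K -> K_smoothing K T -> 0 < d -> 0 <= r -> X f ->
  lebesgue_outer [set z : 'rV[R]_(n + n) | ~ (gauge K (lsubmx z - rsubmx z) <= d ->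
    `|f (lsubmx z) - f (rsubmx z)| <= r)] = 0%E ->
  lebesgue_outer [set z : 'rV[R]_(n + n) | ~ (gauge K (lsubmx z - rsubmx z) <= d ->
    `|T f (lsubmx z) - T f (rsubmx z)| <= r)] = 0%E.
Proof.
move=> hX hT hK sK smooth d0 r0 Xf fz.
(* The weak inequality [ratr q <= T f y] also covers levels whose superlevel set has infinite
   measure, where it holds almost everywhere; it still contradicts T f y < q. *)
have /choice[N NP] : forall q : rat, exists N : set 'rV[R]_n, lebesgue_outer N = 0%E /\
    forall x y, ~ N x -> ~ N y -> ratr q + r < T f x -> gauge K (x - y) <= d ->
    ratr q <= T f y.
  move=> q; have [TX Teq _] := hT.
  have [[qfin Xq]|qae] := space_levels (ratr q) hX (TX _ Xf).
    have [|N [N0 NP]] := smoothing_level_pairs hX hT hK sK smooth d0 r0 Xf fz _ Xq.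
      by apply: le_lt_trans qfin; rewrite [leRHS](Teq _ Xf).
    by exists N; split => // x y Nx Ny qx xy; apply: ltW; exact: NP xy.
  by exists [set x | ~ ratr q <= T f x]; split => // x y _ /contrapT.
pose NN := \bigcup_k (if unpickle k is Some q then N q else set0).
have NN0 : lebesgue_outer NN = 0%E.
  apply: lebesgue_outer_null_bigcup => k.
  by case: (unpickle k) => [q|]; [exact: (NP q).1|exact: lebesgue_outer0].
have NNq q x : ~ NN x -> ~ N q x.
  by move=> nNN Nx; apply: nNN; exists (pickle q); rewrite ?pickleK.
have key x y : ~ NN x -> ~ NN y -> gauge K (x - y) <= d -> T f x - T f y <= r.
  move=> Nx Ny xy; rewrite leNgt; apply/negP => rxy.
  have [q] := @rat_in_itvoo R (T f y) (T f x - r) ltac:(lra).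
  rewrite in_itv/= => /andP[yq qx].
  have := (NP q).2 x y (NNq _ _ Nx) (NNq _ _ Ny) _ xy.
  by rewrite leNgt yq => /(_ ltac:(lra)).
apply: lebesgue_outer_null_subset (lebesgue_outer_null_setU
  (lebesgue_outer_null_rows_prod (Q := setT) (or_introl NN0))
  (lebesgue_outer_null_rows_prod (P := setT) (or_intror NN0))).
move=> z bad; have [?|Nx] := pselect (NN (lsubmx z)); first by left.
have [?|Ny] := pselect (NN (rsubmx z)); first by right.
exfalso; apply: bad => xy; rewrite ler_norml lerNl opprB; apply/andP; split.
  by apply: key => //; rewrite -opprB gaugeN.
exact: key.
Qed.

Lemma smoothing_reduces_modulus (R : realType) (n : nat) (X : set ('rV[R]_n -> R)) T
    (K : set 'rV[R]_n) f (d : R) :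
  X = @space_S R n \/ X = @space_V R n -> rearrangement X T ->
  convex_body_o K -> o_symmetric K -> K_smoothing K T -> 0 < d -> X f ->
  (K_modulus K d (T f) <= K_modulus K d f)%E.
Proof.
move=> hX hT hK sK smooth d0 Xf; apply: ereal_inf_le_tmp => s /= /ae_lebesgueP fz.
apply/ae_lebesgueP.
(* A negative bound can hold only if almost no pair is close, a condition in which the function no
   longer occurs. *)
have neg : (s < 0)%E -> lebesgue_outer [set z : 'rV[R]_(n + n) |
    ~ (gauge K (lsubmx z - rsubmx z) <= d ->
      (`|T f (lsubmx z) - T f (rsubmx z)|%:E <= s)%E)] = 0%E.
  move=> s0; apply: lebesgue_outer_null_subset fz => z nz gz; apply: nz => g.
  by have := gz g; rewrite leNgt (lt_le_trans s0)// lee_fin.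
case: s fz neg => [r||] fz neg.
- have [r0|r0] := leP 0 r; last by apply: neg; rewrite lte_fin.
  by have := smoothing_pairs hX hT hK sK smooth d0 r0 Xf fz.
- by rewrite (_ : mkset _ = set0) ?lebesgue_outer0// -subset0 => z /=; rewrite leey.
- by apply: neg.
Qed.

(** * Gauge distance to a set and the associated contraction *)

Definition gauge_dist (R : realType) (n : nat) (K A : set 'rV[R]_n) (x : 'rV[R]_n) : R :=
  inf [set gauge K (x - a) | a in A].

Lemma gauge_dist_le (R : realType) (n : nat) (K A : set 'rV[R]_n) x a :
  convex_body_o K -> A a -> gauge_dist K A x <= gauge K (x - a).
Proof.
move=> hK Aa; apply: ge_inf; last by exists a.
by exists 0 => _ [b _ <-]; exact: gauge_ge0.
Qed.

Lemma gauge_dist_adherent (R : realType) (n : nat) (K A : set 'rV[R]_n) x (e : R) :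
  convex_body_o K -> A !=set0 -> gauge_dist K A x < e ->
  exists2 a, A a & gauge K (x - a) < e.
Proof.
move=> hK [a Aa] xe.
have h : has_inf [set gauge K (x - a) | a in A].
  by split; [exists (gauge K (x - a)), a|exists 0 => _ [b _ <-]; exact: gauge_ge0].
have [|_ [b Ab <-] xb] := @inf_adherent _ _ (e - gauge_dist K A x) _ h.
  by rewrite subr_gt0.
by exists b => //; move: xb; rewrite -/(gauge_dist K A x) [ltRHS]addrC subrK.
Qed.

Lemma gauge_dist_lipschitz (R : realType) (n : nat) (K A : set 'rV[R]_n) x y :
  convex_body_o K -> A !=set0 ->
  gauge_dist K A x <= gauge K (x - y) + gauge_dist K A y.
Proof.
move=> hK A0; apply/ler_addgt0Pr => e e0.
have [|a Aa ya] := @gauge_dist_adherent _ _ K A y (gauge_dist K A y + e) hK A0.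
  by rewrite ltrDl.
apply: (le_trans (gauge_dist_le x hK Aa)); rewrite -addrA.
have -> : x - a = (x - y) + (y - a) by apply/rowP => i; rewrite !mxE; ring.
by apply: (le_trans (gaugeD _ _ hK)); rewrite lerD2l ltW.
Qed.

Lemma gauge0 (R : realType) (n : nat) (K : set 'rV[R]_n) :
  convex_body_o K -> gauge K 0 = 0.
Proof.
move=> hK; apply/eqP; rewrite eq_le gauge_ge0// andbT; apply: gauge_le => //.
by exists 0; [exact: convex_body0|rewrite scaler0].
Qed.

(** Equal to [d] on a nonempty [A], with slope 1 in the gauge, and positive exactly on the open
    neighbourhood of radius [d]; for bounded [A] this has finite measure, so the function belongs to
    both spaces. *)
Definition cone_fun (R : realType) (n : nat) (K A : set 'rV[R]_n) (d : R) (x : 'rV[R]_n) : R :=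
  Num.max 0 (d - gauge_dist K A x).

Lemma cone_fun_contraction (R : realType) (n : nat) (K A : set 'rV[R]_n) (d : R) :
  convex_body_o K -> o_symmetric K -> A !=set0 -> K_contraction K (cone_fun K A d).
Proof.
move=> hK sK A0 x y; have := gauge_dist_lipschitz x y hK A0.
have := gauge_dist_lipschitz y x hK A0; rewrite -(gaugeN (y - x) sK) opprB.
have := gauge_ge0 (x - y) hK; rewrite /cone_fun.
move: (gauge K _) (gauge_dist K A x) (gauge_dist K A y) => g u v g0 vu uv.
rewrite ler_norml /Order.max.
by have [?|?] := ltP 0 (d - u); have [?|?] := ltP 0 (d - v); apply/andP; split; lra.
Qed.

Lemma superlevel_cone (R : realType) (n : nat) (K A : set 'rV[R]_n) (d t : R) :
  convex_body_o K -> A !=set0 -> 0 <= t ->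
  superlevel (cone_fun K A d) t = gauge_nbhd K (d - t) A.
Proof.
move=> hK A0 t0; apply/seteqP; split => x.
  rewrite /superlevel/cone_fun/= lt_max ltNge t0/= => xt.
  by have [|a Aa xa] := @gauge_dist_adherent _ _ K A x (d - t) hK A0; [lra|exists a].
move=> [a Aa xa]; rewrite /superlevel/cone_fun/= lt_max; apply/orP; right.
by have := gauge_dist_le x hK Aa; lra.
Qed.

Lemma minkowski_lty (R : realType) (n : nat) (K A : set 'rV[R]_n) (d : R) :
  convex_body_o K -> bounded_set A -> 0 < d ->
  (lebesgue_outer (minkowski_sum A (dilate d K)) < +oo)%E.
Proof.
move=> hK [b [_ bA]] d0; have [M M0 MK] := convex_body_norm hK.
apply: le_lt_trans (lebesgue_outer_ball_lty 0 (`|b| + 1 + d * M + 1)).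
apply: le_lebesgue_outer => _ [a Aa [_ [k Kk <-] <-]].
rewrite -ball_normE/= sub0r normrN ltr_pwDr// (le_trans (ler_normD _ _))//.
rewrite lerD// ?normrZ ?(gtr0_norm d0) ?ler_pM2l ?MK//.
by apply: bA Aa; rewrite (le_lt_trans (ler_norm _))// ltrDl.
Qed.

Lemma diamond_star_set0 (R : realType) (n : nat) (X : set ('rV[R]_n -> R)) T :
  X = @space_S R n \/ X = @space_V R n -> rearrangement X T ->
  diamond_star T set0 = set0.
Proof.
move=> hX hT; rewrite -subset0 => x /density_points_ball/(_ ltr01)/eqP; apply.
have D0 : lebesgue_outer (diamond T set0) = 0%E.
  by rewrite (diamond_outer hX hT)// ?lebesgue_outer0//; exact: measurable0.
by apply: lebesgue_outer_null_subset D0 => y [].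
Qed.

Lemma reduces_modulus_smoothing (R : realType) (n : nat) (X : set ('rV[R]_n -> R)) T
    (K : set 'rV[R]_n) :
  X = @space_S R n \/ X = @space_V R n -> rearrangement X T ->
  convex_body_o K -> o_symmetric K ->
  (forall (d : R) (f : 'rV[R]_n -> R), 0 < d -> X f -> K_contraction K f ->
    (K_modulus K d (T f) <= K_modulus K d f)%E) ->
  K_smoothing K T.
Proof.
move=> hX hT hK sK red d A d0 bA mA; apply/negligible_lebesgueP.
(* The empty set is treated apart: its [gauge_dist] is the default 0 of [inf], and [cone_fun] would
   be the constant [d]. *)
have [A0|/nonemptyPn ->] := pselect (A !=set0); last first.
  rewrite (diamond_star_set0 hX hT) (_ : _ `\` _ = set0) ?lebesgue_outer0//.
  by rewrite -subset0 => x [[]].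
have X0 : lower_value X 0 by case: hX => [?|?]; [left|right].
have Xt t : 0 <= t -> level_value X t by move=> t0; case: hX => [?|?]; [left|right].
set M := minkowski_sum A _.
have Mfin : (lebesgue_outer M < +oo)%E by exact: minkowski_lty.
have mM : measurable (M : set (Rn R n)) by exact: minkowski_measurable.
pose f := cone_fun K A d.
have fE t : 0 <= t -> superlevel f t = gauge_nbhd K (d - t) A by exact: superlevel_cone.
have AM : A `<=` M.
  by move=> a Aa; exists a => //; exists 0; [exists 0;
    [exact: convex_body0|rewrite scaler0]|rewrite addr0].
have fM t : 0 <= t -> superlevel f t `<=` M.
  move=> t0 x; rewrite fE// => -[a Aa xa]; apply: gauge_nbhd_sub => //.
  by exists a => //; rewrite (lt_le_trans xa)// gerBl.
have Xf : X f.
  apply: (space_intro X0 Mfin) => [x||t t0]; [by rewrite /f/cone_fun le_max lexx|exact: fM|].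
  by rewrite fE//; apply: open_measurable_rV; exact: gauge_nbhd_open.
have mf := space_measurable hX Xf.
have ffin t : 0 <= t -> (lebesgue_outer (superlevel f t) < +oo)%E.
  by move=> t0; apply: le_lt_trans Mfin; apply: le_lebesgue_outer; exact: fM.
have Afin : (lebesgue_outer A < +oo)%E by apply: le_lt_trans Mfin; exact: le_lebesgue_outer.
have lev t (t0 : 0 <= t) := rearrangement_superlevel hX hT Xf (ffin t t0) (Xt t t0).
have subset_null (B C : set 'rV[R]_n) : B `<=` C -> lebesgue_outer (B `\` C) = 0%E.
  by move=> BC; rewrite (_ : _ `\` _ = set0) ?lebesgue_outer0// -subset0 => x [/BC].
apply: ess_sub_trans (minkowski_boundary_null _ hK d0) _.
apply: (@ess_sub_trans _ _ _ (superlevel (T f) 0)); last first.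
  apply: ess_sub_trans (lev 0 (lexx _)).1 _.
  apply: ess_sub_trans (diamond_mono hX hT (mf 0) mM Mfin _) _.
    by apply: subset_null; exact: fM.
  exact: (density_points_ess_eq (diamond_measurable hX hT mM Mfin)).1.
have [TX _ _] := hT; have mTf := space_measurable hX (TX _ Xf).
have mQ : measurable (~` superlevel (T f) 0 : set (Rn R n)) by exact: measurableC.
apply: lebesgue_outer_null_subset (sub_density_points mQ) => y [[x Dx yx] nTy].
split => // Qy.
have xy : gauge K (x - y) < d by rewrite -opprB gaugeN.
have g0 := gauge_ge0 (x - y) hK.
(* The modulus is used at [d1] instead of [d]. A contraction has modulus at most d1 < u there,
   whereas close pairs with T f > u near [x] and T f <= 0 near [y] differ by more than [u]. The
   bound u < d is needed because [f] equals [d] on [A], so that [A] lies in the strict superlevel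
   set at [u]. *)
pose d1 := (gauge K (x - y) + d) / 2; pose u := (d1 + d) / 2.
have xd1 : gauge K (x - y) < d1 by rewrite /d1; lra.
have d1u : d1 < u by rewrite /u/d1; lra.
have ud : u < d by rewrite /u/d1; lra.
have d10 : 0 < d1 by rewrite (le_lt_trans g0).
have u0 : 0 <= u by rewrite ltW// (lt_trans d10).
have DP : lebesgue_outer (diamond T A `\` superlevel (T f) u) = 0%E.
  apply: ess_sub_trans _ (lev u u0).2.
  apply: (diamond_mono hX hT mA (mf u) (ffin u u0)); apply: subset_null => a Aa.
  by rewrite fE//; exists a => //; rewrite subrr gauge0// subr_gt0.
have Pball r : 0 < r -> lebesgue_outer (superlevel (T f) u `&` ball x r) != 0%E.
  move=> r0; apply: contra_neq (density_points_ball Dx r0) => P0.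
  apply: lebesgue_outer_null_subset (lebesgue_outer_null_setU P0 DP) => w [Dw xw].
  by have [Pw|nPw] := pselect (superlevel (T f) u w); [left|right].
have /eqP := close_pairs_not_null hK xd1 Pball (fun r => density_points_ball Qy).
have fc := @cone_fun_contraction _ _ K A d hK sK A0.
have : (K_modulus K d1 (T f) < u%:E)%E.
  apply: le_lt_trans (_ : d1%:E < u%:E)%E; last by rewrite lte_fin.
  apply: le_trans (red d1 f d10 Xf fc) _.
  apply: ereal_inf_lbound; apply: aeW => z zd.
  by rewrite lee_fin; exact: le_trans (fc _ _) zd.
move=> /ereal_inf_lt[s /= /ae_lebesgueP s0 su]; apply.
apply: lebesgue_outer_null_subset s0 => z [Pz Qz zd1] /= /(_ zd1).
move=> /le_lt_trans/(_ su); rewrite lte_fin; apply/negP; rewrite -leNgt.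
move/negP: Qz; rewrite -leNgt => Qz; rewrite /superlevel/= in Pz.
by rewrite (le_trans _ (ler_norm _))//; lra.
Qed.

Theorem corollary4p12 (R : realType) (n : nat) (hn : (2 <= n)%N)
  (X : set ('rV[R]_n -> R)) (hX : X = @space_S R n \/ X = @space_V R n)
  (K : set 'rV[R]_n) (hK : convex_body_o K) (hKsym : o_symmetric K)
  (T : ('rV[R]_n -> R) -> ('rV[R]_n -> R)) (hT : rearrangement X T) :
  [<-> forall (d : R) (f : 'rV[R]_n -> R), 0 < d -> X f ->
         (K_modulus K d (T f) <= K_modulus K d f)%E;
       forall (d : R) (f : 'rV[R]_n -> R), 0 < d -> X f -> K_contraction K f ->
         (K_modulus K d (T f) <= K_modulus K d f)%E;
       K_smoothing K T].
Proof.
tfae.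
- by move=> red d f d0 Xf _; exact: red.
- exact: (reduces_modulus_smoothing hX).
- by move=> smooth d f; exact: (smoothing_reduces_modulus hX).
Qed.
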